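(* For every $\lambda$-term $M\in\Lambda$ we have $\mathcal{T}_n(\mathrm{BT}(M))=\mathrm{NF}(\mathcal{T}(M))$, where $\mathcal{T}_n(\mathrm{BT}(M))=\bigcup_{A\in\mathcal{A}(M)}\mathcal{T}_n(A)$.
   Context: Call-by-value $\lambda$-calculus with permutations: fix a denumerable set of variables; $\lambda$-terms and values are $M,N::=V\mid MN$ and $V::=x\mid \lambda x.M$ (application associates to the left), up to $\alpha$-conversion; $M\{x:=N\}$ is capture-avoiding substitution and $\mathrm{FV}(M)$ the set of free variables. Rules: $(\beta_v)$ $(\lambda x.M)V\to M\{x:=V\}$ if $V$ is a value; $(\sigma_1)$ $(\lambda x.M)NP\to(\lambda x.MP)N$ if $x\notin\mathrm{FV}(P)$; $(\sigma_3)$ $V((\lambda x.M)N)\to(\lambda x.VM)N$ if $V$ is a value and $x\notin\mathrm{FV}(V)$. $\to_{\mathsf v}$ is the contextual closure of the union of these rules, $\twoheadrightarrow_{\mathsf v}$ its reflexive-transitive closure. Approximants: $\Lambda_\bot$ is the set of $\lambda$-terms possibly containing a constant $\bot$ (in $\Lambda_\bot$, $\bot$ counts as a value). $\sqsubseteq$ is the smallest context-closed preorder on $\Lambda_\bot$ with $\bot\sqsubseteq x$ and $\bot\sqsubseteq\lambda x.M$ for all variables $x$ and $M\in\Lambda_\bot$. The set $\mathcal A$ of approximants is generated by ($k\ge0$): $A::=B\mid C$; $B::=x\mid\lambda x.A\mid\bot\mid xBA_1\cdots A_k$; $C::=(\lambda x.A)(yBA_1\cdots A_k)$. For $M\in\Lambda$,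 $\mathcal A(M)=\{A\in\mathcal A\mid \exists N\in\Lambda,\ M\twoheadrightarrow_{\mathsf v}N,\ A\sqsubseteq N\}$, and the Böhm tree $\mathrm{BT}(M)$ is the supremum $\bigsqcup\mathcal A(M)$. Resource calculus: resource values $u,v::=x\mid\lambda x.t$; simple terms $s,t::=st\mid[v_1,\dots,v_k]$ ($k\ge0$; a bag $[v_1,\dots,v_k]$ is a finite multiset); resource terms are resource values or simple terms. $[x^n]$ is the bag with $n$ copies of $x$. Linear substitution: if $x$ has exactly $n$ free occurrences in $e$, enumerated $x_1,\dots,x_n$, then $e\langle x:=v_1,\dots,v_n\rangle=\{e[x_1:=v_{\pi(1)},\dots,x_n:=v_{\pi(n)}]\mid \pi\text{ a permutation of }\{1,\dots,n\}\}$, and otherwise it is $\emptyset$. Constructors are extended to sets multilinearly: $\lambda x.\mathcal T=\{\lambda x.t\mid t\in\mathcal T\}$, $\mathcal S\mathcal T=\{st\mid s\in\mathcal S,t\in\mathcal T\}$, $[\mathcal V_1,\dots,\mathcal V_k]=\{[v_1,\dots,v_k]\mid v_i\in\mathcal V_i\}$. Rules: $(\beta_r)$ $[\lambda x.t][v_1,\dots,v_n]\to t\langle x:=v_1,\dots,v_n\rangle$; $(0)$ $[v_1,\dots,v_n]t\to\emptyset$ if $n\ne1$; $(\sigma_1)$ $[\lambda x.t]s_1s_2\to[\lambda x.ts_2]s_1$ if $x\notin\mathrm{FV}(s_1)$; $(\sigma_3)$ $[v]([\lambda x.t]s)\to[\lambda x.[v]t]s$ if $x\notin\mathrm{FV}(v)$.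 $\to_{\mathsf r}$ (between finite sets of resource terms) is the smallest relation containing these rules and closed under: $t\to\mathcal T$ implies $\lambda x.t\to\lambda x.\mathcal T$; $s\to\mathcal S$ implies $st\to\mathcal S t$; $t\to\mathcal T$ implies $st\to s\mathcal T$; $v_0\to\mathcal V_0$ implies $[v_0,v_1,\dots,v_k]\to[\mathcal V_0,v_1,\dots,v_k]$; $e\to\mathcal E_1$ and $e\notin\mathcal E_2$ imply $\{e\}\cup\mathcal E_2\to\mathcal E_1\cup\mathcal E_2$. $\to_{\mathsf r}$ is confluent and strongly normalizing; $\mathrm{nf}(e)$ is the (finite set) normal form of $e$ and $\mathrm{NF}(\mathcal E)=\bigcup_{e\in\mathcal E}\mathrm{nf}(e)$. Taylor expansion: $\mathcal T(x)=\{[x^n]\mid n\ge0\}$, $\mathcal T(\lambda x.N)=\{[\lambda x.t_1,\dots,\lambda x.t_n]\mid n\ge0,\ t_i\in\mathcal T(N)\}$, $\mathcal T(PQ)=\{st\mid s\in\mathcal T(P),t\in\mathcal T(Q)\}$. Normalized Taylor expansion of approximants: $\mathcal T_n(x)=\{[x^n]\mid n\ge0\}$; $\mathcal T_n(\lambda x.A')=\{[\lambda x.t_1,\dots,\lambda x.t_n]\mid n\ge0,\ t_i\in\mathcal T_n(A')\}$; $\mathcal T_n(\bot)=\{[\,]\}$; $\mathcal T_n(xBA_1\cdots A_k)=\{[x]t_0t_1\cdots t_k\mid t_0\in\mathcal T_n(B),\ t_i\in\mathcal T_n(A_i)\}$; $\mathcal T_n((\lambda x.A')(yBA_1\cdots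 A_k))=\{[\lambda x.s]t\mid s\in\mathcal T_n(A'),\ t\in\mathcal T_n(yBA_1\cdots A_k)\}$. *)

(* Defs.v *)
From Stdlib Require Import Arith List Permutation Relations.
Import ListNotations.

Inductive term : Type :=
| Var : nat -> term
| Lam : term -> term
| App : term -> term -> term
| Bot : term.

Fixpoint bot_free (M : term) : Prop :=
  match M with
  | Var _ => True
  | Lam N => bot_free N
  | App P Q => bot_free P /\ bot_free Q
  | Bot => False
  end.

Definition is_value (M : term) : Prop :=
  match M with Var _ | Lam _ => True | _ => False end.

Fixpoint lift (k c : nat) (M : term) : term :=
  match M with
  | Var n => if n <? c then Var n else Var (n + k)
  | Lam N => Lam (lift k (S c) N)
  | App P Q => App (lift k c P) (lift k c Q)
  | Bot => Bot
  end.

Fixpoint subst (c : nat) (N M : term) : term :=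
  match M with
  | Var n => if n =? c then lift c 0 N
             else if c <? n then Var (n - 1) else Var n
  | Lam P => Lam (subst (S c) N P)
  | App P Q => App (subst c N P) (subst c N Q)
  | Bot => Bot
  end.

Inductive red_v : term -> term -> Prop :=
| rv_beta : forall M V, is_value V -> red_v (App (Lam M) V) (subst 0 V M)
| rv_sigma1 : forall M N P,
    red_v (App (App (Lam M) N) P) (App (Lam (App M (lift 1 0 P))) N)
| rv_sigma3 : forall V M N, is_value V ->
    red_v (App V (App (Lam M) N)) (App (Lam (App (lift 1 0 V) M)) N)
| rv_lam : forall M M', red_v M M' -> red_v (Lam M) (Lam M')
| rv_appl : forall M M' N, red_v M M' -> red_v (App M N) (App M' N)
| rv_appr : forall M N N', red_v N N' -> red_v (App M N) (App M N').

Definition red_v_star : term -> term -> Prop := clos_refl_trans term red_v.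

Inductive sqle : term -> term -> Prop :=
| sq_refl : forall M, sqle M M
| sq_trans : forall M N P, sqle M N -> sqle N P -> sqle M P
| sq_bot_var : forall x, sqle Bot (Var x)
| sq_bot_lam : forall M, sqle Bot (Lam M)
| sq_lam : forall M M', sqle M M' -> sqle (Lam M) (Lam M')
| sq_app : forall M M' N N', sqle M M' -> sqle N N' -> sqle (App M N) (App M' N').

(* Approximants.  isH captures the spines  x B A_1 ... A_k  (k >= 0).  *)
Inductive isA : term -> Prop :=
| A_B : forall M, isB M -> isA M
| A_C : forall A H, isA A -> isH H -> isA (App (Lam A) H)
with isB : term -> Prop :=
| B_var : forall x, isB (Var x)
| B_lam : forall A, isA A -> isB (Lam A)
| B_bot : isB Bot
| B_head : forall H, isH H -> isB H
with isH : term -> Prop :=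
| H_base : forall x B, isB B -> isH (App (Var x) B)
| H_app : forall H A, isH H -> isA A -> isH (App H A).

Definition approx_of (M A : term) : Prop :=
  isA A /\ exists N, bot_free N /\ red_v_star M N /\ sqle A N.

(* Resource calculus (de Bruijn); bags are lists taken up to permutation *)
Inductive rval : Type :=
| RVar : nat -> rval
| RLam : rsimp -> rval
with rsimp : Type :=
| RApp : rsimp -> rsimp -> rsimp
| RBag : list rval -> rsimp.

Fixpoint rliftv (k c : nat) (v : rval) : rval :=
  match v with
  | RVar n => if n <? c then RVar n else RVar (n + k)
  | RLam t => RLam (rlifts k (S c) t)
  end
with rlifts (k c : nat) (s : rsimp) : rsimp :=
  match s with
  | RApp s1 s2 => RApp (rlifts k c s1) (rlifts k c s2)
  | RBag l => RBag ((fix go (l : list rval) := match l with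
                      | [] => [] | v :: l' => rliftv k c v :: go l' end) l)
  end.

Inductive eqv : rval -> rval -> Prop :=
| eqv_var : forall n, eqv (RVar n) (RVar n)
| eqv_lam : forall t t', eqs t t' -> eqv (RLam t) (RLam t')
with eqs : rsimp -> rsimp -> Prop :=
| eqs_app : forall s s' t t', eqs s s' -> eqs t t' -> eqs (RApp s t) (RApp s' t')
| eqs_bag : forall l l', eqbag l l' -> eqs (RBag l) (RBag l')
with eqbag : list rval -> list rval -> Prop :=
| eqb_nil : eqbag [] []
| eqb_cons : forall v w l m, eqv v w -> eqbag l m -> eqbag (v :: l) (w :: m)
| eqb_perm : forall l l' m, Permutation l l' -> eqbag l' m -> eqbag l m.

(* Linear substitution t<d := vs> of the variable of index d (at depth d)
   by the multiset vs of values: lsubs d vs t t' means t' is one of the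
   terms t[x_1 := v_pi(1), ..., x_n := v_pi(n)] (empty if the number of
   occurrences differs from the size of vs). *)
Inductive lsubv : nat -> list rval -> rval -> rval -> Prop :=
| lsv_hit : forall d w, lsubv d [w] (RVar d) (rliftv d 0 w)
| lsv_miss : forall d n, n <> d ->
    lsubv d [] (RVar n) (RVar (if n <? d then n else n - 1))
| lsv_lam : forall d vs t t', lsubs (S d) vs t t' -> lsubv d vs (RLam t) (RLam t')
with lsubs : nat -> list rval -> rsimp -> rsimp -> Prop :=
| lss_app : forall d vs vs1 vs2 s s' t t', Permutation vs (vs1 ++ vs2) ->
    lsubs d vs1 s s' -> lsubs d vs2 t t' -> lsubs d vs (RApp s t) (RApp s' t')
| lss_bag : forall d vs l l', lsubbag d vs l l' -> lsubs d vs (RBag l) (RBag l')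
with lsubbag : nat -> list rval -> list rval -> list rval -> Prop :=
| lsb_nil : forall d, lsubbag d [] [] []
| lsb_cons : forall d vs vs1 vs2 v v' l l', Permutation vs (vs1 ++ vs2) ->
    lsubv d vs1 v v' -> lsubbag d vs2 l l' -> lsubbag d vs (v :: l) (v' :: l').

Inductive redv : rval -> (rval -> Prop) -> Prop :=
| rdv_lam : forall t T, reds t T ->
    redv (RLam t) (fun v => exists t', T t' /\ v = RLam t')
with reds : rsimp -> (rsimp -> Prop) -> Prop :=
| rds_beta : forall t vs,
    reds (RApp (RBag [RLam t]) (RBag vs)) (fun u => lsubs 0 vs t u)
| rds_zero : forall l t, length l <> 1 ->
    reds (RApp (RBag l) t) (fun _ => False)
| rds_sigma1 : forall t s1 s2,
    reds (RApp (RApp (RBag [RLam t]) s1) s2)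
         (fun u => u = RApp (RBag [RLam (RApp t (rlifts 1 0 s2))]) s1)
| rds_sigma3 : forall v t s,
    reds (RApp (RBag [v]) (RApp (RBag [RLam t]) s))
         (fun u => u = RApp (RBag [RLam (RApp (RBag [rliftv 1 0 v]) t)]) s)
| rds_appl : forall s t S, reds s S ->
    reds (RApp s t) (fun u => exists s', S s' /\ u = RApp s' t)
| rds_appr : forall s t T, reds t T ->
    reds (RApp s t) (fun u => exists t', T t' /\ u = RApp s t')
| rds_bag : forall l1 v l2 V, redv v V ->
    reds (RBag (l1 ++ v :: l2)) (fun u => exists v', V v' /\ u = RBag (l1 ++ v' :: l2)).

(* set-level step:  {e} U E2 -> E1 U E2  when e -> E1 and e \notin E2 *)
Definition set_step (S S' : rsimp -> Prop) : Prop :=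
  exists e E1, S e /\ reds e E1 /\
    forall u, S' u <-> ((S u /\ ~ eqs u e) \/ E1 u).

Definition set_normal (S : rsimp -> Prop) : Prop :=
  forall u, S u -> ~ exists E, reds u E.

Definition nf (e t : rsimp) : Prop :=
  exists S, clos_refl_trans (rsimp -> Prop) set_step (fun u => u = e) S
    /\ set_normal S /\ S t.

Fixpoint taylor (M : term) : rsimp -> Prop :=
  match M with
  | Var x => fun s => exists n, s = RBag (repeat (RVar x) n)
  | Lam N => fun s => exists ts, Forall (taylor N) ts /\ s = RBag (map RLam ts)
  | App P Q => fun s => exists s1 s2, taylor P s1 /\ taylor Q s2 /\ s = RApp s1 s2
  | Bot => fun _ => False   (* T is only defined on Lambda *)
  end.

(* Normalized Taylor expansion of approximants; Tnh handles the head
   part  x B A_1 ... A_j  of a spine. *)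
Fixpoint Tn (A : term) : rsimp -> Prop :=
  match A with
  | Var x => fun s => exists n, s = RBag (repeat (RVar x) n)
  | Lam A' => fun s => exists ts, Forall (Tn A') ts /\ s = RBag (map RLam ts)
  | Bot => fun s => s = RBag []
  | App (Lam A') H =>
      fun s => exists s1 t, Tn A' s1 /\ Tn H t /\ s = RApp (RBag [RLam s1]) t
  | App P Q => fun s => exists s1 t, Tnh P s1 /\ Tn Q t /\ s = RApp s1 t
  end
with Tnh (P : term) : rsimp -> Prop :=
  match P with
  | Var x => fun s => s = RBag [RVar x]
  | App P Q => fun s => exists s1 t, Tnh P s1 /\ Tn Q t /\ s = RApp s1 t
  | _ => fun _ => False
  end.

Definition Tn_BT (M : term) : rsimp -> Prop :=
  fun t => exists A, approx_of M A /\ Tn A t.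

Definition NF_taylor (M : term) : rsimp -> Prop :=
  fun t => exists s, taylor M s /\ nf s t.

Definition rset_eq (S1 S2 : rsimp -> Prop) : Prop :=
  forall t, (exists u, S1 u /\ eqs t u) <-> (exists u, S2 u /\ eqs t u).

(* Main.v *)
(** A term t belongs to nf(s) iff t is normal and some single-term path
    s -> S1, s1 in S1, s1 -> S2, ... leads to t: the path can be performed inside
    the set, and the rest of the set then normalizes without touching t. So no
    confluence of the resource calculus is needed.

    From Tn(BT(M)) to NF(T(M)): if A is below a reduct N of M, then the elements of
    Tn(A) are normal elements of T(N), and every step M -> N can be undone on the
    elements of T(N) that contain no redex of the rule (0).

    Conversely, a reduct of an element of T(M) need not lie in T(N) for any single
    reduct N of M, since the elements of a bag are reduced independently. It does lie in
    the relation [tri], which lets each subterm choose its own reduct. Normal elements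
    of T(N) stay in T(N') when N reduces to N', so for a normal term the choices
    can be unified by confluence of the call-by-value calculus, and an approximant
    is read off N. That confluence follows from Hindley-Rosen, applied to parallel
    beta_v and to the (strongly normalizing, locally confluent) sigma rules. *)

Require Import Defs.
From Stdlib Require Import Arith List Permutation Relations Lia Classical.
Import ListNotations.

(** * Abstract rewriting: commutation, Hindley-Rosen and Newman *)

Notation star := (clos_refl_trans _).

Definition commutes {A : Type} (R S : A -> A -> Prop) : Prop :=
  forall a b c, R a b -> S a c -> exists d, S b d /\ R c d.

Lemma commutes_sym {A : Type} (R S : A -> A -> Prop) :
  commutes R S -> commutes S R.
Proof.
  intros H a b c Hb Hc. destruct (H _ _ _ Hc Hb) as (d & ? & ?). eauto.
Qed.

(** Since the [R] step is always closed by a single [R] step, it can be pushed along an [S] path of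
    any length, one square after the other. *)
Lemma commutes_star_r {A : Type} (R S : A -> A -> Prop) :
  (forall a b c, R a b -> S a c -> exists d, star S b d /\ R c d) ->
  commutes R (star S).
Proof.
  intros H a b c HR HS. revert b HR.
  induction HS as [a c HS | a | a c1 c _ IH1 _ IH2]; intros b HR.
  - eauto.
  - exists b. split; [apply rt_refl | assumption].
  - destruct (IH1 _ HR) as (d1 & H1 & H2). destruct (IH2 _ H2) as (d & H3 & H4).
    exists d. split; [eapply rt_trans; eassumption | assumption].
Qed.

Lemma commutes_star {A : Type} (R S : A -> A -> Prop) :
  commutes R S -> commutes (star R) (star S).
Proof.
  intros H. apply commutes_sym, commutes_star_r. intros a b c HS HR.
  assert (HRS : commutes R (star S)).
  { apply commutes_star_r. intros a' b' c' H1 H2.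
    destruct (H _ _ _ H1 H2) as (d & ? & ?). exists d. split; [now apply rt_step | assumption]. }
  destruct (HRS _ _ _ HR HS) as (d & ? & ?). exists d. split; [now apply rt_step | assumption].
Qed.

(** Taking the closures inside the union makes every local square close in one step on each side, so
    that [commutes_star] applies. *)
Lemma hindley_rosen {A : Type} (R S : A -> A -> Prop) :
  commutes (star R) (star R) -> commutes (star S) (star S) ->
  commutes (star R) (star S) ->
  commutes (star (fun a b => star R a b \/ star S a b))
           (star (fun a b => star R a b \/ star S a b)).
Proof.
  intros HR HS HRS. pose proof (commutes_sym _ _ HRS) as HSR.
  apply commutes_star. intros a b c [H1 | H1] [H2 | H2].
  - destruct (HR _ _ _ H1 H2) as (d & ? & ?); eauto.
  - destruct (HRS _ _ _ H1 H2) as (d & ? & ?); eauto.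
  - destruct (HSR _ _ _ H1 H2) as (d & ? & ?); eauto.
  - destruct (HS _ _ _ H1 H2) as (d & ? & ?); eauto.
Qed.

(** Termination is given by a measure into [nat]. Local confluence closes the peak of the two first
    steps, and the induction hypothesis is then used at each of the two targets. *)
Lemma newman {A : Type} (R : A -> A -> Prop) (mu : A -> nat) :
  (forall a b, R a b -> mu b < mu a) ->
  (forall a b c, R a b -> R a c -> exists d, star R b d /\ star R c d) ->
  commutes (star R) (star R).
Proof.
  intros Hmu Hloc a. induction a as [a IH] using (well_founded_induction
    (well_founded_ltof A mu)). unfold ltof in IH.
  intros b c Hb Hc.
  apply clos_rt_rt1n in Hb. apply clos_rt_rt1n in Hc.
  destruct Hb as [ | b1 b Hb1 Hb].
  { exists c. split; [now apply clos_rt1n_rt | apply rt_refl]. }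
  destruct Hc as [ | c1 c Hc1 Hc].
  { exists b. split; [apply rt_refl |].
    eapply rt_trans; [apply rt_step, Hb1 | now apply clos_rt1n_rt]. }
  apply clos_rt1n_rt in Hb. apply clos_rt1n_rt in Hc.
  destruct (Hloc _ _ _ Hb1 Hc1) as (d & H1 & H2).
  destruct (IH b1 (Hmu _ _ Hb1) _ _ Hb H1) as (e & H3 & H4).
  assert (H5 : star R c1 e) by (eapply rt_trans; eassumption).
  destruct (IH c1 (Hmu _ _ Hc1) _ _ Hc H5) as (f & H6 & H7).
  exists f. split; [eapply rt_trans; eassumption | assumption].
Qed.

(** With [f] a one-hole context this is a congruence property; with [f] the identity it compares two
    closures. *)
Lemma star_map {A B : Type} (R : A -> A -> Prop) (S : B -> B -> Prop) (f : A -> B) :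
  (forall a b, R a b -> star S (f a) (f b)) ->
  forall a b, star R a b -> star S (f a) (f b).
Proof.
  intros H a b Hab. induction Hab; eauto using rt_refl, rt_trans.
Qed.

(** * Confluence of the call-by-value calculus *)

Ltac nat_cases :=
  repeat match goal with
  | |- context [?a <? ?b] => destruct (Nat.ltb_spec a b)
  | |- context [?a =? ?b] => destruct (Nat.eqb_spec a b)
  | H : context [?a <? ?b] |- _ => destruct (Nat.ltb_spec a b)
  | H : context [?a =? ?b] |- _ => destruct (Nat.eqb_spec a b)
  end.

Lemma lift_0 M : forall c, lift 0 c M = M.
Proof.
  induction M; intros c; simpl; try congruence.
  nat_cases; f_equal; lia.
Qed.

Lemma lift_lift_fuse M : forall j k c d, c <= d <= c + k ->
  lift j d (lift k c M) = lift (j + k) c M.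
Proof.
  induction M; intros j k c d H; simpl.
  - nat_cases; simpl; nat_cases; f_equal; lia.
  - f_equal. apply IHM. lia.
  - f_equal; auto.
  - reflexivity.
Qed.

Lemma lift_lift_comm M : forall j k c d, c <= d ->
  lift j (d + k) (lift k c M) = lift k c (lift j d M).
Proof.
  induction M; intros j k c d H; simpl.
  - nat_cases; simpl; nat_cases; f_equal; lia.
  - f_equal. apply (IHM j k (S c) (S d)). lia.
  - f_equal; auto.
  - reflexivity.
Qed.

Lemma lift_subst_le M : forall k c d N, c <= d ->
  lift k c (subst d N M) = subst (d + k) N (lift k c M).
Proof.
  induction M; intros k c d N H; simpl.
  - nat_cases; simpl; nat_cases; try (f_equal; lia).
    rewrite lift_lift_fuse by lia. f_equal; lia.
  - f_equal. apply (IHM k (S c) (S d)). lia.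
  - f_equal; auto.
  - reflexivity.
Qed.

Lemma lift_subst_ge M : forall k c d N, d <= c ->
  lift k c (subst d N M) = subst d (lift k (c - d) N) (lift k (S c) M).
Proof.
  induction M; intros k c d N H; simpl.
  - nat_cases; simpl; nat_cases; try (f_equal; lia); try lia.
    replace c with ((c - d) + d) at 1 by lia. apply lift_lift_comm. lia.
  - f_equal. apply (IHM k (S c) (S d)). lia.
  - f_equal; auto.
  - reflexivity.
Qed.

(** Lifting by [S k] leaves no variable at the indices from [c] to [c + k], so the substitution
    finds no occurrence and only closes the gap by one. *)
Lemma subst_lift_fuse M : forall k c d N, c <= d <= c + k ->
  subst d N (lift (S k) c M) = lift k c M.
Proof.
  induction M; intros k c d N H; simpl.
  - nat_cases; simpl; nat_cases; try (f_equal; lia); try lia.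
  - f_equal. apply IHM. lia.
  - f_equal; auto.
  - reflexivity.
Qed.

Lemma subst_lift M c N : subst c N (lift 1 c M) = M.
Proof. rewrite subst_lift_fuse by lia. apply lift_0. Qed.

Lemma subst_subst M : forall d e N P, d <= e ->
  subst e N (subst d P M) = subst d (subst (e - d) N P) (subst (S e) N M).
Proof.
  induction M; intros d e N P H; simpl.
  - nat_cases; simpl; nat_cases; try (f_equal; lia); try lia.
    + rewrite subst_lift_fuse by lia. f_equal; lia.
    + rewrite lift_subst_le by lia. f_equal. lia.
  - f_equal. apply (IHM (S d) (S e)). lia.
  - f_equal; auto.
  - reflexivity.
Qed.

Lemma is_value_lift k c V : is_value V -> is_value (lift k c V).
Proof. destruct V; simpl; nat_cases; simpl; tauto. Qed.

Lemma is_value_subst c N V : is_value N -> is_value V -> is_value (subst c N V).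
Proof.
  destruct V; simpl; nat_cases; simpl; try tauto; intros; now apply is_value_lift.
Qed.

(** * Parallel [beta_v], the sigma rules, and their commutation *)

Inductive par : term -> term -> Prop :=
| par_var x : par (Var x) (Var x)
| par_bot : par Bot Bot
| par_lam M M' : par M M' -> par (Lam M) (Lam M')
| par_app M M' N N' : par M M' -> par N N' -> par (App M N) (App M' N')
| par_beta M M' V V' : is_value V -> par M M' -> par V V' ->
    par (App (Lam M) V) (subst 0 V' M').

Inductive sig : term -> term -> Prop :=
| sig_1 M N P : sig (App (App (Lam M) N) P) (App (Lam (App M (lift 1 0 P))) N)
| sig_3 V M N : is_value V ->
    sig (App V (App (Lam M) N)) (App (Lam (App (lift 1 0 V) M)) N)
| sig_lam M M' : sig M M' -> sig (Lam M) (Lam M')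
| sig_appl M M' N : sig M M' -> sig (App M N) (App M' N)
| sig_appr M N N' : sig N N' -> sig (App M N) (App M N').

Lemma par_refl M : par M M.
Proof. induction M; constructor; assumption. Qed.

Lemma par_value V V' : par V V' -> is_value V -> is_value V'.
Proof. destruct 1; simpl; tauto. Qed.

Lemma sig_value V V' : sig V V' -> is_value V -> is_value V'.
Proof. destruct 1; simpl; tauto. Qed.

Lemma par_lift M M' : par M M' -> forall k c, par (lift k c M) (lift k c M').
Proof.
  induction 1; intros k c; simpl.
  - apply par_refl.
  - constructor.
  - constructor; auto.
  - constructor; auto.
  - rewrite lift_subst_ge, Nat.sub_0_r by lia.
    constructor; auto. now apply is_value_lift.
Qed.

Lemma par_subst M M' : par M M' -> forall c V V', is_value V -> par V V' ->
  par (subst c V M) (subst c V' M').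
Proof.
  induction 1; intros c W W' HW HWW; simpl.
  - nat_cases; auto using par_refl, par_lift.
  - constructor.
  - constructor; auto.
  - constructor; auto.
  - rewrite subst_subst, Nat.sub_0_r by lia.
    constructor; auto. now apply is_value_subst.
Qed.

Lemma par_diamond : commutes par par.
Proof.
  intros M A B HA. revert B.
  induction HA as [x | | M M' HM IHM | M M' N N' HM IHM HN IHN | M M' V V' HV HM IHM HV' IHV];
    intros B HB.
  - inversion HB; subst. eauto using par_refl.
  - inversion HB; subst. eauto using par_refl.
  - inversion HB as [ | | ? M2 HM2 | | ]; subst.
    destruct (IHM _ HM2) as (C & ? & ?). exists (Lam C). split; constructor; assumption.
  - inversion HB as [ | | | ? M2 ? N2 HM2 HN2 | P P2 V V2 HV HP2 HV2]; subst.
    + destruct (IHM _ HM2) as (C & ? & ?), (IHN _ HN2) as (D & ? & ?).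
      exists (App C D). split; constructor; assumption.
    + inversion HM as [ | | ? P' HP' | | ]; subst.
      (* The induction hypothesis speaks of the whole abstraction, not of its body; the body of the
         join is recovered by inverting the two steps between abstractions. *)
      destruct (IHM _ (par_lam _ _ HP2)) as (C & H1 & H2), (IHN _ HV2) as (D & ? & ?).
      inversion H1 as [ | | ? Q H3 | | ]; subst. inversion H2; subst.
      exists (subst 0 D Q). split.
      * constructor; auto. eapply par_value; eassumption.
      * apply par_subst; auto. eapply par_value; eassumption.
  - inversion HB as [ | | | ? M2 ? N2 HM2 HN2 | P P2 W V2 HW HP2 HV2]; subst.
    + inversion HM2 as [ | | ? P' HP' | | ]; subst.
      destruct (IHM _ HP') as (C & ? & ?), (IHV _ HN2) as (D & ? & ?).
      exists (subst 0 D C). split.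
      * apply par_subst; auto. eapply par_value; eassumption.
      * constructor; auto. eapply par_value; eassumption.
    + destruct (IHM _ HP2) as (C & ? & ?), (IHV _ HV2) as (D & ? & ?).
      exists (subst 0 D C). split; apply par_subst; auto; eapply par_value; eassumption.
Qed.

Lemma sig_lift M M' : sig M M' -> forall k c, sig (lift k c M) (lift k c M').
Proof.
  induction 1; intros k c; simpl.
  - replace (S c) with (c + 1) by lia. rewrite (lift_lift_comm P) by lia. constructor.
  - replace (S c) with (c + 1) by lia. rewrite (lift_lift_comm V) by lia.
    constructor. now apply is_value_lift.
  - constructor; auto.
  - constructor; auto.
  - constructor; auto.
Qed.

Lemma sig_subst M M' : sig M M' -> forall c V, is_value V ->
  sig (subst c V M) (subst c V M').
Proof.
  induction 1; intros c W HW; simpl.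
  - replace (S c) with (c + 1) by lia. rewrite <- (lift_subst_le P) by lia. constructor.
  - replace (S c) with (c + 1) by lia. rewrite <- (lift_subst_le V) by lia.
    constructor. now apply is_value_subst.
  - constructor; auto.
  - constructor; auto.
  - constructor; auto.
Qed.

Lemma sig_star_lam M M' : star sig M M' -> star sig (Lam M) (Lam M').
Proof. apply star_map. intros. now apply rt_step, sig_lam. Qed.

Lemma sig_star_app M M' N N' : star sig M M' -> star sig N N' ->
  star sig (App M N) (App M' N').
Proof.
  intros HM HN. apply rt_trans with (App M' N).
  - revert M M' HM. apply (star_map sig sig (fun X => App X N)).
    intros. now apply rt_step, sig_appl.
  - revert N N' HN. apply star_map. intros. now apply rt_step, sig_appr.
Qed.

(** One sigma step is needed for each occurrence of the substituted variable, hence the closure in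
    the conclusion. *)
Lemma sig_star_subst_r M : forall c V V', sig V V' -> star sig (subst c V M) (subst c V' M).
Proof.
  induction M; intros c V V' HV; simpl.
  - nat_cases; auto using rt_refl, rt_step, sig_lift.
  - apply sig_star_lam; auto.
  - apply sig_star_app; auto.
  - apply rt_refl.
Qed.

(** This is the square that [commutes_star_r] asks for: one [par] step closes it, while the sigma
    side may take several steps or none, because [par] can copy or erase a sigma redex. *)
Lemma par_sig_commute M A B : par M A -> sig M B ->
  exists C, star sig A C /\ par B C.
Proof.
  intros HA. revert B.
  induction HA as [x | | M M' HM IHM | M M' N N' HM IHM HN IHN | M M' V V' HV HM IHM HV' IHV];
    intros B HB.
  - inversion HB.
  - inversion HB.
  - inversion HB as [ | | ? M2 HM2 | | ]; subst.
    destruct (IHM _ HM2) as (C & ? & ?). exists (Lam C).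
    split; [now apply sig_star_lam | now constructor].
  - inversion HB as [P Q ? | ? P Q HV | | ? M2 ? HM2 | ? ? N2 HN2]; subst.
    + inversion HM as [ | | | ? L ? Q' HL HQ' | ? P' ? Q' HQ HP' HQ']; subst.
      * inversion HL as [ | | ? P' HP' | | ]; subst.
        exists (App (Lam (App P' (lift 1 0 N'))) Q'). split.
        -- apply rt_step. constructor.
        -- apply par_app; auto. apply par_lam, par_app; auto using par_lift.
      (* The parallel step has contracted the abstraction that the sigma step moves. Contracting it
         after the move gives the same term, since the lifted argument is unaffected by the
         substitution. *)
      * exists (App (subst 0 Q' P') N'). split; [apply rt_refl |].
        replace (App (subst 0 Q' P') N') with (subst 0 Q' (App P' (lift 1 0 N'))).
        -- apply par_beta; auto. apply par_app; auto using par_lift.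
        -- simpl. now rewrite subst_lift.
    + inversion HN as [ | | | ? L ? Q' HL HQ' | ? P' ? Q' HQ HP' HQ']; subst.
      * inversion HL as [ | | ? P' HP' | | ]; subst.
        exists (App (Lam (App (lift 1 0 M') P')) Q'). split.
        -- apply rt_step. constructor. eapply par_value; eassumption.
        -- apply par_app; auto. apply par_lam, par_app; auto using par_lift.
      * exists (App M' (subst 0 Q' P')). split; [apply rt_refl |].
        replace (App M' (subst 0 Q' P')) with (subst 0 Q' (App (lift 1 0 M') P')).
        -- apply par_beta; auto. apply par_app; auto using par_lift.
        -- simpl. now rewrite subst_lift.
    + destruct (IHM _ HM2) as (C & ? & ?). exists (App C N').
      split; [apply sig_star_app; auto using rt_refl | now constructor].
    + destruct (IHN _ HN2) as (C & ? & ?). exists (App M' C).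
      split; [apply sig_star_app; auto using rt_refl | now constructor].
  - inversion HB as [ | ? P Q HL | | ? M2 ? HM2 | ? ? N2 HN2]; subst.
    + simpl in HV. contradiction.
    + inversion HM2 as [ | | ? P2 HP2 | | ]; subst.
      destruct (IHM _ HP2) as (C & H1 & H2). exists (subst 0 V' C). split.
      * revert H1. apply (star_map sig sig (subst 0 V')). intros.
        apply rt_step, sig_subst; auto. eapply par_value; eassumption.
      * now constructor.
    + destruct (IHV _ HN2) as (C & H1 & H2). exists (subst 0 C M'). split.
      * revert H1. apply (star_map sig sig (fun X => subst 0 X M')).
        intros. now apply sig_star_subst_r.
      * constructor; auto. eapply sig_value; eassumption.
Qed.

(** * Termination and local confluence of the sigma rules *)

Fixpoint sig_weight (M : term) : nat :=
  match M with
  | Lam N => S (sig_weight N)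
  | App P Q => sig_weight P * sig_weight Q
  | _ => 2
  end.

Lemma sig_weight_ge2 M : 2 <= sig_weight M.
Proof. induction M; simpl; nia. Qed.

Lemma sig_weight_lift M : forall k c, sig_weight (lift k c M) = sig_weight M.
Proof. induction M; intros k c; simpl; auto. now destruct (_ <? _). Qed.

(** For [sig_1] the weight [(1 + m) * n * p] becomes [(1 + m * p) * n]: the summand [n * p] shrinks
    to [n], a strict decrease as all weights are at least 2. The rule [sig_3] is symmetric. *)
Lemma sig_weight_lt M N : sig M N -> sig_weight N < sig_weight M.
Proof.
  induction 1; simpl; rewrite ?sig_weight_lift;
    repeat match goal with |- context [sig_weight ?X] =>
      lazymatch goal with H : 2 <= sig_weight X |- _ => fail
      | _ => pose proof (sig_weight_ge2 X) end end; nia.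
Qed.

Definition joinable {A : Type} (R : A -> A -> Prop) (a b : A) : Prop :=
  exists c, star R a c /\ star R b c.

Lemma joinable_sym {A : Type} (R : A -> A -> Prop) a b : joinable R a b -> joinable R b a.
Proof. intros (c & ? & ?). now exists c. Qed.

Lemma joinable_step {A : Type} (R : A -> A -> Prop) a b c :
  R a c -> R b c -> joinable R a b.
Proof. intros. exists c. split; now apply rt_step. Qed.

(** The peaks with a root step are isolated here and in [sig_3_joinable], so that local confluence
    can use them on either side through [joinable_sym]. *)
Lemma sig_1_joinable M N P B : sig (App (App (Lam M) N) P) B ->
  joinable sig (App (Lam (App M (lift 1 0 P))) N) B.
Proof.
  intros H. inversion H as [ | ? ? ? HV | | ? X ? HX | ? ? P' HP]; subst.
  - exists (App (Lam (App M (lift 1 0 P))) N). split; apply rt_refl.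
  - simpl in HV. contradiction.
  - inversion HX as [ | ? A B HV | | ? M' ? HM | ? ? N' HN]; subst.
    (* The critical pair: [Lam M] is both the abstraction of [sig_1] and the value of [sig_3]. Both
       sides meet once [M] and [P] have moved under the inner abstraction. *)
    + exists (App (Lam (App (Lam (App (lift 1 1 M) (lift 1 0 (lift 1 0 P)))) A)) B).
      split.
      * eapply rt_trans; [apply rt_step; constructor; simpl; tauto |]. simpl.
        rewrite <- (lift_lift_comm P 1 1 0 0) by lia. apply rt_refl.
      * eapply rt_trans; [apply rt_step; constructor |]. simpl.
        apply rt_step. repeat constructor.
    + inversion HM as [ | | ? M2 HM2 | | ]; subst.
      apply joinable_step with (App (Lam (App M2 (lift 1 0 P))) N);
        [repeat constructor; assumption | constructor].
    + apply joinable_step with (App (Lam (App M (lift 1 0 P))) N'); [| constructor].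
      now apply sig_appr.
  - apply joinable_step with (App (Lam (App M (lift 1 0 P'))) N); [| constructor].
    apply sig_appl, sig_lam, sig_appr, sig_lift, HP.
Qed.

Lemma sig_3_joinable V M N B : is_value V -> sig (App V (App (Lam M) N)) B ->
  joinable sig (App (Lam (App (lift 1 0 V) M)) N) B.
Proof.
  intros HV H. inversion H as [ | ? ? ? HV' | | ? X ? HX | ? ? P' HP]; subst.
  - simpl in HV. contradiction.
  - exists (App (Lam (App (lift 1 0 V) M)) N). split; apply rt_refl.
  - apply joinable_step with (App (Lam (App (lift 1 0 X) M)) N).
    + apply sig_appl, sig_lam, sig_appl, sig_lift, HX.
    + constructor. eapply sig_value; eassumption.
  - inversion HP as [ | ? A B HV' | | ? M' ? HM | ? ? N' HN]; subst.
    + exists (App (Lam (App (Lam (App (lift 1 0 (lift 1 0 V)) (lift 1 1 M))) A)) B).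
      split.
      * eapply rt_trans; [apply rt_step; constructor; simpl; tauto |]. simpl.
        rewrite <- (lift_lift_comm V 1 1 0 0) by lia. apply rt_refl.
      * eapply rt_trans; [apply rt_step; constructor; assumption |]. simpl.
        apply rt_step, sig_appl, sig_lam, sig_3. now apply is_value_lift.
    + inversion HM as [ | | ? M2 HM2 | | ]; subst.
      apply joinable_step with (App (Lam (App (lift 1 0 V) M2)) N).
      * now apply sig_appl, sig_lam, sig_appr.
      * now constructor.
    + apply joinable_step with (App (Lam (App (lift 1 0 V) M)) N').
      * now apply sig_appr.
      * now constructor.
Qed.

Lemma sig_locally_confluent M A B : sig M A -> sig M B -> joinable sig A B.
Proof.
  intros HA. revert B.
  induction HA as [M N P | V M N HV | M M' HM IH | M M' N HM IH | M N N' HN IH];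
    intros B HB.
  - now apply sig_1_joinable.
  - now apply sig_3_joinable.
  - inversion HB as [ | | ? M2 HM2 | | ]; subst.
    destruct (IH _ HM2) as (C & ? & ?). exists (Lam C). split; now apply sig_star_lam.
  - inversion HB as [ | | | ? M2 ? HM2 | ? ? N2 HN2]; subst.
    + apply joinable_sym, sig_1_joinable. now apply sig_appl.
    + apply joinable_sym, sig_3_joinable; auto. now apply sig_appl.
    + destruct (IH _ HM2) as (C & ? & ?). exists (App C N).
      split; apply sig_star_app; auto using rt_refl.
    + apply joinable_step with (App M' N2); now constructor.
  - inversion HB as [ | | | ? M2 ? HM2 | ? ? N2 HN2]; subst.
    + apply joinable_sym, sig_1_joinable. now apply sig_appr.
    + apply joinable_sym, sig_3_joinable; auto. now apply sig_appr.
    + apply joinable_step with (App M2 N'); now constructor.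
    + destruct (IH _ HN2) as (C & ? & ?). exists (App M C).
      split; apply sig_star_app; auto using rt_refl.
Qed.

(** * Congruence, stability under substitution, and confluence of [red_v] *)

Lemma red_v_star_lam M M' : star red_v M M' -> star red_v (Lam M) (Lam M').
Proof. apply star_map. intros. now apply rt_step, rv_lam. Qed.

Lemma red_v_star_app M M' N N' : star red_v M M' -> star red_v N N' ->
  star red_v (App M N) (App M' N').
Proof.
  intros HM HN. apply rt_trans with (App M' N).
  - revert M M' HM. apply (star_map red_v red_v (fun X => App X N)).
    intros. now apply rt_step, rv_appl.
  - revert N N' HN. apply star_map. intros. now apply rt_step, rv_appr.
Qed.

Lemma par_red_v M N : par M N -> star red_v M N.
Proof.
  induction 1; auto using rt_refl, red_v_star_lam, red_v_star_app.
  eapply rt_trans.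
  - apply red_v_star_app; [apply red_v_star_lam |]; eassumption.
  - apply rt_step, rv_beta. eapply par_value; eassumption.
Qed.

Lemma sig_red_v M N : sig M N -> red_v M N.
Proof. induction 1; now constructor. Qed.

Lemma red_v_par_or_sig M N : red_v M N -> par M N \/ sig M N.
Proof.
  induction 1 as [ | | | ? ? _ [] | ? ? ? _ [] | ? ? ? _ []];
    (left; constructor; auto using par_refl; fail) || (right; now constructor).
Qed.

Lemma red_v_star_lift k c M N : star red_v M N -> star red_v (lift k c M) (lift k c N).
Proof.
  apply star_map. intros a b [H | H]%red_v_par_or_sig.
  - now apply par_red_v, par_lift.
  - now apply rt_step, sig_red_v, sig_lift.
Qed.

Lemma red_v_star_subst c V M N : is_value V ->
  star red_v M N -> star red_v (subst c V M) (subst c V N).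
Proof.
  intros HV. apply star_map. intros a b [H | H]%red_v_par_or_sig.
  - apply par_red_v, par_subst; auto using par_refl.
  - now apply rt_step, sig_red_v, sig_subst.
Qed.

Lemma red_v_confluent : commutes (star red_v) (star red_v).
Proof.
  (* [T] has the same reflexive-transitive closure as [red_v], so the result of [hindley_rosen] for
     [T] transfers. *)
  set (T := fun M N => star par M N \/ star sig M N).
  assert (HT : commutes (star T) (star T)).
  { apply hindley_rosen.
    - apply commutes_star, par_diamond.
    - apply newman with sig_weight; [apply sig_weight_lt |].
      intros M A B. apply sig_locally_confluent.
    - apply commutes_sym, commutes_star_r. intros M A B HB HA.
      assert (H : commutes par (star sig)) by (apply commutes_star_r, par_sig_commute).
      destruct (H _ _ _ HA HB) as (C & ? & ?). exists C. split; [now apply rt_step | assumption]. }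
  assert (HvT : forall M N, star red_v M N -> star T M N).
  { apply (star_map _ _ (fun X => X)). intros M N [H | H]%red_v_par_or_sig;
      apply rt_step; [left | right]; now apply rt_step. }
  assert (HTv : forall M N, star T M N -> star red_v M N).
  { apply (star_map _ _ (fun X => X)). intros M N [H | H]; revert M N H;
      apply (star_map _ _ (fun X => X)); intros; auto using par_red_v, rt_step, sig_red_v. }
  intros M A B HA HB. destruct (HT _ _ _ (HvT _ _ HA) (HvT _ _ HB)) as (C & ? & ?).
  exists C. auto.
Qed.

Lemma bot_free_lift M : forall k c, bot_free M -> bot_free (lift k c M).
Proof. induction M; simpl; intros k c H; nat_cases; simpl; firstorder. Qed.

Lemma bot_free_subst M : forall c N, bot_free N -> bot_free M -> bot_free (subst c N M).
Proof.
  induction M; simpl; intros c N HN H; nat_cases; simpl; auto using bot_free_lift.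
  destruct H. auto.
Qed.

Lemma bot_free_red_v M N : star red_v M N -> bot_free M -> bot_free N.
Proof.
  intros H. induction H as [M N H | | ]; auto.
  induction H; simpl in *; intuition auto using bot_free_subst, bot_free_lift.
Qed.

(** * Normalization of the resource calculus *)

Scheme lsubv_ind' := Minimality for lsubv Sort Prop
  with lsubs_ind' := Minimality for lsubs Sort Prop
  with lsubbag_ind' := Minimality for lsubbag Sort Prop.
Combined Scheme lsub_ind from lsubv_ind', lsubs_ind', lsubbag_ind'.

Scheme redv_ind' := Minimality for redv Sort Prop
  with reds_ind' := Minimality for reds Sort Prop.
Combined Scheme red_ind from redv_ind', reds_ind'.

Section ResourceInduction.
Variables (P : rval -> Prop) (Q : rsimp -> Prop).
Hypothesis Pvar : forall n, P (RVar n).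
Hypothesis Plam : forall t, Q t -> P (RLam t).
Hypothesis Qapp : forall s t, Q s -> Q t -> Q (RApp s t).
Hypothesis Qbag : forall l, Forall P l -> Q (RBag l).

(** Bags nest values inside lists, and a generated mutual principle has no hypothesis for the list
    elements; the inner fixpoint supplies it as a [Forall]. *)
Fixpoint rval_nested_ind v : P v :=
  match v with
  | RVar n => Pvar n
  | RLam t => Plam t (rsimp_nested_ind t)
  end
with rsimp_nested_ind t : Q t :=
  match t with
  | RApp s1 s2 => Qapp s1 s2 (rsimp_nested_ind s1) (rsimp_nested_ind s2)
  | RBag l => Qbag l ((fix go l : Forall P l :=
      match l with
      | [] => Forall_nil P
      | v :: l' => Forall_cons v (rval_nested_ind v) (go l')
      end) l)
  end.

Lemma resource_ind : (forall v, P v) /\ (forall t, Q t).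
Proof. split; [exact rval_nested_ind | exact rsimp_nested_ind]. Qed.
End ResourceInduction.

Lemma rlifts_bag k c l : rlifts k c (RBag l) = RBag (map (rliftv k c) l).
Proof. reflexivity. Qed.

(* The weight is chosen so that linear substitution multiplies it by at most
   the weights of the substituted values; every rule then strictly decreases it. *)
Fixpoint wv (v : rval) : nat :=
  match v with
  | RVar _ => 1
  | RLam t => S (ws t)
  end
with ws (t : rsimp) : nat :=
  match t with
  | RApp s1 s2 => ws s1 * ws s2
  | RBag l => 2 * (fix go l := match l with [] => 1 | v :: l' => wv v * go l' end) l
  end.

Definition wl (l : list rval) : nat := fold_right (fun v n => wv v * n) 1 l.

Lemma ws_bag l : ws (RBag l) = 2 * wl l.
Proof. reflexivity. Qed.

Lemma weight_pos : (forall v, 1 <= wv v) /\ (forall t, 2 <= ws t).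
Proof.
  apply resource_ind.
  - intros. simpl. lia.
  - intros. simpl. lia.
  - intros. simpl. nia.
  - intros l Hl. rewrite ws_bag. assert (1 <= wl l); [| lia].
    induction Hl; simpl; nia.
Qed.

Definition wv_pos := proj1 weight_pos.
Definition ws_pos := proj2 weight_pos.

Lemma wl_pos l : 1 <= wl l.
Proof. pose proof (ws_pos (RBag l)) as H. rewrite ws_bag in H. lia. Qed.

Lemma wl_app l m : wl (l ++ m) = wl l * wl m.
Proof. induction l; simpl; nia. Qed.

Lemma wl_perm l m : Permutation l m -> wl l = wl m.
Proof. induction 1; simpl; nia. Qed.

Lemma weight_lift : (forall v k c, wv (rliftv k c v) = wv v) /\
  (forall t k c, ws (rlifts k c t) = ws t).
Proof.
  apply resource_ind.
  - intros. simpl. now destruct (_ <? _).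
  - intros. simpl. auto.
  - intros. simpl. auto.
  - intros l Hl k c. rewrite rlifts_bag, !ws_bag. f_equal.
    induction Hl; simpl; auto.
Qed.

Lemma weight_lsub :
  (forall d vs v v', lsubv d vs v v' -> wv v' <= wv v * wl vs) /\
  (forall d vs t t', lsubs d vs t t' -> ws t' <= ws t * wl vs) /\
  (forall d vs l l', lsubbag d vs l l' -> wl l' <= wl l * wl vs).
Proof.
  apply lsub_ind.
  - intros. simpl. rewrite (proj1 weight_lift). lia.
  - intros. simpl. lia.
  - intros d vs t t' _ H. simpl. pose proof (wl_pos vs). nia.
  - intros d vs vs1 vs2 s s' t t' Hp _ Hs _ Ht.
    rewrite (wl_perm _ _ Hp), wl_app. simpl.
    pose proof (Nat.mul_le_mono _ _ _ _ Hs Ht). nia.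
  - intros d vs l l' _ H. rewrite !ws_bag. nia.
  - intros. simpl. lia.
  - intros d vs vs1 vs2 v v' l l' Hp _ Hv _ Hl.
    rewrite (wl_perm _ _ Hp), wl_app. simpl.
    pose proof (Nat.mul_le_mono _ _ _ _ Hv Hl). nia.
Qed.

(** Linear substitution is bounded by [weight_lsub], and the sigma rules decrease for the same
    reason as with [sig_weight]: the factor 2 on bags keeps every simple term, even an empty bag, at
    weight at least 2. *)
Lemma weight_red :
  (forall v V, redv v V -> forall v', V v' -> wv v' < wv v) /\
  (forall t T, reds t T -> forall t', T t' -> ws t' < ws t).
Proof.
  apply red_ind.
  - intros t T _ IH v' (t' & Ht & ->). simpl. specialize (IH _ Ht). lia.
  - intros t vs t' H. apply (proj1 (proj2 weight_lsub)) in H.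
    change (ws (RApp (RBag [RLam t]) (RBag vs))) with (ws (RBag [RLam t]) * ws (RBag vs)).
    rewrite !ws_bag. simpl. pose proof (wl_pos vs). nia.
  - intros l t _ t' [].
  - intros t s1 s2 t' ->.
    simpl. rewrite (proj2 weight_lift).
    pose proof (ws_pos s1). pose proof (ws_pos s2). pose proof (ws_pos t). nia.
  - intros v t s t' ->. simpl. rewrite (proj1 weight_lift).
    pose proof (ws_pos s). pose proof (ws_pos t). pose proof (wv_pos v). nia.
  - intros s t S _ IH t' (s' & Hs & ->). specialize (IH _ Hs). simpl.
    pose proof (ws_pos t). nia.
  - intros s t S _ IH t' (s' & Hs & ->). specialize (IH _ Hs). simpl.
    pose proof (ws_pos s). nia.
  - intros l1 v l2 V _ IH t' (v' & Hv & ->). specialize (IH _ Hv).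
    rewrite !ws_bag, !wl_app. simpl. pose proof (wl_pos l1). pose proof (wl_pos l2).
    assert (wv v' * wl l2 < wv v * wl l2) by nia. nia.
Qed.

(** * Finiteness of the set of reducts of a resource step *)

Definition finite {A : Type} (P : A -> Prop) : Prop :=
  exists l, forall a, P a -> In a l.

Lemma finite_subset {A : Type} (P Q : A -> Prop) :
  finite Q -> (forall a, P a -> Q a) -> finite P.
Proof. intros (l & Hl) H. exists l. auto. Qed.

(** The covering list of [P] may contain elements outside [P], where nothing is known of [F];
    excluded middle discards them. *)
Lemma finite_bind {A B : Type} (P : A -> Prop) (F : A -> B -> Prop) :
  finite P -> (forall a, P a -> finite (F a)) ->
  finite (fun b => exists a, P a /\ F a b).
Proof.
  intros (l & Hl) HF.
  assert (H : forall m, finite (fun b => exists a, In a m /\ P a /\ F a b)).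
  { induction m as [| a m (k & Hk)].
    - exists []. intros b (? & [] & _).
    - assert (Ha : finite (fun b => P a /\ F a b)).
      { destruct (classic (P a)) as [HP | HP].
        - destruct (HF _ HP) as (k' & Hk'). exists k'. intros b []. auto.
        - exists []. intros b []. contradiction. }
      destruct Ha as (k' & Hk'). exists (k' ++ k).
      intros b (a' & [<- | Ha'] & HP & HF'); apply in_or_app; [left | right]; eauto. }
  apply (finite_subset _ _ (H l)). intros b (a & ? & ?). eauto.
Qed.

Lemma finite_image {A B : Type} (P : A -> Prop) (f : A -> B) :
  finite P -> finite (fun b => exists a, P a /\ b = f a).
Proof.
  intros H. apply finite_bind; auto. intros a _. exists [f a]. intros b ->. now left.
Qed.

Lemma finite_image2 {A B C : Type} (P : A -> Prop) (Q : B -> Prop) (f : A -> B -> C) :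
  finite P -> finite Q -> finite (fun c => exists a b, P a /\ Q b /\ c = f a b).
Proof.
  intros HP HQ.
  apply finite_subset with (fun c => exists a, P a /\ exists b, Q b /\ c = f a b).
  - apply finite_bind; auto. intros a _. now apply finite_image.
  - intros c (a & b & ? & ? & ->). eauto.
Qed.

(** A permutation of [l] is in particular a list of the same length with entries in [l], and these
    are finitely many by induction on the length. *)
Lemma finite_permutations {A : Type} (l : list A) : finite (Permutation l).
Proof.
  assert (H : forall n, finite (fun m => length m = n /\ incl m l)).
  { induction n as [| n IH].
    - exists [[]]. intros [| a m] [? ?]; simpl in *; auto; discriminate.
    - eapply finite_subset.
      + apply (finite_image2 (fun a => In a l) (fun m => length m = n /\ incl m l) (@cons A));
          [now exists l | exact IH].
      + intros [| a m] [Hl Hi]; [discriminate |]. exists a, m.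
        apply incl_cons_inv in Hi. simpl in Hl. intuition. }
  eapply finite_subset; [apply (H (length l)) |]. intros m Hm. split.
  - symmetry. now apply Permutation_length.
  - intros a Ha. eapply Permutation_in; [symmetry |]; eassumption.
Qed.

Lemma finite_splits {A : Type} (l : list A) :
  finite (fun p => Permutation l (fst p ++ snd p)).
Proof.
  eapply finite_subset.
  - apply (finite_bind (Permutation l) (fun m p => m = fst p ++ snd p)).
    + apply finite_permutations.
    (* The cut position ranges from 0 to [length m] inclusive, hence the successor. *)
    + intros m _. exists (map (fun n => (firstn n m, skipn n m)) (seq 0 (S (length m)))).
      intros [p q] ->. apply in_map_iff. exists (length p). simpl fst. simpl snd.
      rewrite firstn_app, skipn_app, Nat.sub_diag, firstn_all, skipn_all, app_nil_r.
      split; [reflexivity |]. apply in_seq. rewrite length_app. lia.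
  - intros p Hp. now exists (fst p ++ snd p).
Qed.

Lemma lsub_finite :
  (forall v d vs, finite (lsubv d vs v)) /\ (forall t d vs, finite (lsubs d vs t)).
Proof.
  apply resource_ind.
  (* A hit forces [vs = [w]], so that [hd] returns [w]; in the other cases the first candidate is a
     harmless surplus, whatever the default [RVar 0]. *)
  - intros n d vs. exists [rliftv d 0 (hd (RVar 0) vs); RVar (if n <? d then n else n - 1)].
    intros v H. inversion H; subst; simpl; auto.
  - intros t IH d vs. eapply finite_subset; [apply (finite_image _ RLam (IH (S d) vs)) |].
    intros v H. inversion H; subst. eauto.
  - intros s t IHs IHt d vs. eapply finite_subset.
    + apply (finite_bind _ (fun p u => exists s' t', lsubs d (fst p) s s' /\
        lsubs d (snd p) t t' /\ u = RApp s' t') (finite_splits vs)).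
      intros p _. now apply finite_image2.
    + intros u H. inversion H as [? ? vs1 vs2 | ]; subst. exists (vs1, vs2). simpl. eauto 10.
  - intros l Hl d vs.
    assert (H : finite (lsubbag d vs l)).
    { revert vs. induction Hl as [| v l Hv _ IH]; intros vs.
      - exists [[]]. intros m H. inversion H; subst; simpl; auto.
      - eapply finite_subset.
        + apply (finite_bind _ (fun p u => exists v' l', lsubv d (fst p) v v' /\
            lsubbag d (snd p) l l' /\ u = v' :: l') (finite_splits vs)).
          intros p _. now apply finite_image2.
        + intros u H. inversion H as [| ? ? vs1 vs2]; subst.
          exists (vs1, vs2). simpl. eauto 10. }
    eapply finite_subset; [apply (finite_image _ RBag H) |].
    intros u H'. inversion H'; subst. eauto.
Qed.

Lemma red_finite :
  (forall v V, redv v V -> finite V) /\ (forall t T, reds t T -> finite T).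
Proof.
  apply red_ind; intros.
  - now apply finite_image.
  - apply lsub_finite.
  - exists []. tauto.
  - eexists [_]. intros u ->. now left.
  - eexists [_]. intros u ->. now left.
  - now apply (finite_image _ (fun s' => RApp s' t)).
  - now apply finite_image.
  - now apply (finite_image _ (fun v' => RBag (l1 ++ v' :: l2))).
Qed.

(** * Reducibility up to permutation of bags, and normalization of finite sets *)

Lemma eqbag_length l m : eqbag l m -> length l = length m.
Proof.
  induction 1; simpl; auto. rewrite (Permutation_length H). assumption.
Qed.

Lemma eqbag_in_r l m : eqbag l m -> forall w, In w m -> exists v, In v l /\ eqv v w.
Proof.
  induction 1 as [| v w l m Hvw _ IH | l l' m Hp _ IH]; intros u Hu.
  - destruct Hu.
  - destruct Hu as [<- | Hu].
    + exists v. simpl. auto.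
    + destruct (IH _ Hu) as (x & ? & ?). exists x. simpl. auto.
  - destruct (IH _ Hu) as (x & Hx & ?). exists x. split; auto.
    eapply Permutation_in; [symmetry |]; eassumption.
Qed.

Lemma eqs_singleton_r t v : eqs t (RBag [v]) -> exists w, t = RBag [w] /\ eqv w v.
Proof.
  intros H. inversion H as [| l ? Hl]; subst.
  pose proof (eqbag_length _ _ Hl) as Hn.
  destruct (eqbag_in_r _ _ Hl v) as (w & Hw & Hwv); [now left |].
  destruct l as [| x [|]]; try discriminate. destruct Hw as [-> | []]. eauto.
Qed.

Lemma eqs_lam_singleton_r t u : eqs t (RBag [RLam u]) -> exists w, t = RBag [RLam w].
Proof.
  intros (v & -> & H)%eqs_singleton_r. inversion H; subst. eauto.
Qed.

Definition reducible (t : rsimp) : Prop := exists T, reds t T.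

(** A [set_step] discards every element equivalent to the contracted one. As reducibility is
    invariant under this equivalence, a normal element is never discarded. *)
Lemma red_eq :
  (forall v V, redv v V -> forall w, eqv w v -> exists W, redv w W) /\
  (forall t T, reds t T -> forall u, eqs u t -> reducible u).
Proof.
  apply red_ind.
  - intros t T _ IH w Hw. inversion Hw as [| t' ? Ht]; subst.
    destruct (IH _ Ht) as (T' & ?). eexists. constructor. eassumption.
  - intros t vs u Hu. inversion Hu as [s ? s' ? Hs Hs' |]; subst.
    apply eqs_lam_singleton_r in Hs as (w & ->).
    inversion Hs' as [| l]; subst. eexists. apply rds_beta.
  - intros l t Hl u Hu. inversion Hu as [s ? s' ? Hs Hs' |]; subst.
    inversion Hs as [| m ? Hm]; subst. eexists. apply rds_zero.
    now rewrite (eqbag_length _ _ Hm).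
  - intros t s1 s2 u Hu. inversion Hu as [s ? s' ? Hs Hs' |]; subst.
    inversion Hs as [r ? r' ? Hr Hr' |]; subst.
    apply eqs_lam_singleton_r in Hr as (w & ->). eexists. apply rds_sigma1.
  - intros v t s u Hu. inversion Hu as [r ? r' ? Hr Hr' |]; subst.
    apply eqs_singleton_r in Hr as (w & -> & _).
    inversion Hr' as [x ? x' ? Hx Hx' |]; subst.
    apply eqs_lam_singleton_r in Hx as (y & ->). eexists. apply rds_sigma3.
  - intros s t S _ IH u Hu. inversion Hu as [r ? r' ? Hr Hr' |]; subst.
    destruct (IH _ Hr) as (T' & ?). eexists. apply rds_appl. eassumption.
  - intros s t S _ IH u Hu. inversion Hu as [r ? r' ? Hr Hr' |]; subst.
    destruct (IH _ Hr') as (T' & ?). eexists. apply rds_appr. eassumption.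
  - intros l1 v l2 V _ IH u Hu. inversion Hu as [| m ? Hm]; subst.
    destruct (eqbag_in_r _ _ Hm v) as (w & Hw & Hwv); [apply in_elt |].
    destruct (IH _ Hwv) as (W & HW). apply in_split in Hw as (m1 & m2 & ->).
    eexists. apply rds_bag. eassumption.
Qed.

Definition may_step (s t : rsimp) : Prop := exists T, reds s T /\ T t.

Definition contract (e : rsimp) (E S : rsimp -> Prop) : rsimp -> Prop :=
  fun u => (S u /\ ~ eqs u e) \/ E u.

Lemma set_step_contract (S : rsimp -> Prop) e E :
  S e -> reds e E -> set_step S (contract e E S).
Proof. intros He HE. exists e, E. unfold contract. firstorder. Qed.

Lemma finite_contract (S : rsimp -> Prop) e E :
  finite S -> reds e E -> finite (contract e E S).
Proof.
  intros (l & Hl) (k & Hk)%(proj2 red_finite). exists (l ++ k).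
  intros u [[Hu _] | Hu]; apply in_or_app; auto.
Qed.

Lemma eqs_refl t : eqs t t.
Proof.
  revert t. apply (resource_ind (fun v => eqv v v)); intros; constructor; auto.
  induction H; now constructor.
Qed.

(** The descent is lexicographic: outside, the bound on the weights of reducible elements; inside, a
    list covering those that may attain the largest weight. The element [t] survives each
    contraction by [red_eq]. *)
Lemma set_normalizes_keeping (t : rsimp) : ~ reducible t ->
  forall n (S : rsimp -> Prop), finite S -> S t ->
  (forall u, S u -> reducible u -> ws u < n) ->
  exists S', star set_step S S' /\ set_normal S' /\ S' t.
Proof.
  intros Ht. induction n as [| n IHn]; intros S Hfin HSt Hw.
  - exists S. split; [apply rt_refl |]. split; [| assumption].
    intros u Hu Hr. specialize (Hw u Hu Hr). lia.
  - (* A contraction removes one reducible element of weight n from the list l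
       and only adds lighter ones. *)
    assert (H : forall l (S : rsimp -> Prop), finite S -> S t ->
      (forall u, S u -> reducible u -> ws u < n \/ ws u <= n /\ In u l) ->
      exists S', star set_step S S' /\ set_normal S' /\ S' t).
    { clear S Hfin HSt Hw. induction l as [| e l IHl]; intros S Hfin HSt Hw.
      - apply IHn; auto. intros u Hu Hr. destruct (Hw u Hu Hr) as [| [_ []]]; auto.
      - destruct (classic (S e /\ reducible e)) as [[He Hr] | Hn].
        + pose proof Hr as (E & HE).
          assert (HS : set_step S (contract e E S)) by now apply set_step_contract.
          destruct (IHl (contract e E S)) as (S' & H1 & H2).
          * now apply finite_contract.
          * left. split; auto. intros Heq. apply Ht.
            eapply (proj2 red_eq); eassumption.
          * intros u [[Hu Hue] | Hu] Hru.
            -- destruct (Hw u Hu Hru) as [| [? [-> | ?]]]; auto.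
               destruct Hue. apply eqs_refl.
            -- apply (proj2 weight_red _ _ HE) in Hu.
               destruct (Hw e He Hr); lia.
          * exists S'. split; [| assumption].
            eapply rt_trans; [apply rt_step |]; eassumption.
        + apply IHl; auto. intros u Hu Hru.
          destruct (Hw u Hu Hru) as [| [? [<- | ?]]]; auto. tauto. }
    destruct Hfin as (l & Hl). apply (H l); auto.
    + now exists l.
    + intros u Hu Hr. right. split; auto. specialize (Hw u Hu Hr). lia.
Qed.

Lemma may_steps_nf s t : star may_step s t -> ~ reducible t -> nf s t.
Proof.
  intros Hst Ht.
  assert (H : forall S : rsimp -> Prop, finite S -> S s ->
    exists S', star set_step S S' /\ finite S' /\ S' t).
  { apply clos_rt_rt1n in Hst. clear Ht.
    induction Hst as [s | s s1 t (E & HE & Hs1) _ IH]; intros S Hfin HS.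
    - exists S. auto using rt_refl.
    - destruct (IH (contract s E S)) as (S' & H1 & H2).
      + now apply finite_contract.
      + now right.
      + exists S'. split; [| assumption].
        eapply rt_trans; [apply rt_step, set_step_contract; eassumption | assumption]. }
  destruct (H (fun u => u = s)) as (S1 & H1 & Hfin & HS1); auto.
  { exists [s]. intros u ->. now left. }
  destruct Hfin as (l & Hl).
  destruct (set_normalizes_keeping t Ht (Datatypes.S (list_max (map ws l))) S1)
    as (S2 & H2 & H3 & H4); auto.
  - now exists l.
  - intros u Hu _. apply Nat.lt_succ_r.
    assert (Hm : Forall (fun k => k <= list_max (map ws l)) (map ws l)) by now apply list_max_le.
    rewrite Forall_forall in Hm. apply Hm, in_map, Hl, Hu.
  - exists S2. split; [| auto]. eapply rt_trans; eassumption.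
Qed.

(** An element of a reached set was either there before the last contraction or comes from the
    contracted term, which is itself reachable from [s]. *)
Lemma nf_may_steps s t : nf s t -> star may_step s t /\ ~ reducible t.
Proof.
  intros (S & HS & Hn & Ht). split; [| exact (Hn t Ht)].
  apply clos_rt_rtn1 in HS. revert t Ht. clear Hn.
  induction HS as [| S1 S2 (e & E & He & HE & Heq) _ IH]; intros t Ht.
  - subst. apply rt_refl.
  - apply Heq in Ht as [[Ht _] | Ht]; auto.
    eapply rt_trans; [apply IH, He |]. apply rt_step. now exists E.
Qed.

(** * Forward simulation *)

Definition normal_val (v : rval) : Prop :=
  match v with RLam t => ~ reducible t | RVar _ => True end.

(** The shape that enables sigma1 in function position and, next to a singleton bag, sigma3 in
    argument position. *)
Definition lam_app (t : rsimp) : Prop :=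
  exists u s, t = RApp (RBag [RLam u]) s.

Lemma normal_bag l : ~ reducible (RBag l) <-> Forall normal_val l.
Proof.
  rewrite Forall_forall. split.
  - intros H [n | t] Hv; simpl; auto. intros (T & HT). apply H.
    apply in_split in Hv as (l1 & l2 & ->). eexists. apply rds_bag, rdv_lam, HT.
  - intros H (T & HT). inversion HT as [ | | | | | | l1 v l2 V HV]; subst.
    inversion HV as [t T' HT']; subst. apply (H (RLam t)); [apply in_elt | now exists T'].
Qed.

(** The clauses on the shape of [s] and [t] exclude the root rules one by one: [~ lam_app s] sigma1,
    the singleton patterns (0), [~ lam_app t] sigma3, and the last inequality beta. *)
Lemma normal_app s t : ~ reducible (RApp s t) <->
  ~ reducible s /\ ~ reducible t /\ ~ lam_app s /\
  match s with
  | RBag [RLam _] => ~ lam_app t /\ forall l, t <> RBag l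
  | RBag [_] => ~ lam_app t
  | RBag _ => False
  | _ => True
  end.
Proof.
  split.
  - intros H.
    assert (H1 : forall l, s = RBag l -> length l = 1).
    { intros l ->. apply NNPP. intros Hl. apply H. eexists. now apply rds_zero. }
    assert (H2 : forall v, s = RBag [v] -> ~ lam_app t).
    { intros v -> (u & r & ->). apply H. eexists. apply rds_sigma3. }
    repeat split.
    + intros (T & HT). apply H. eexists. apply rds_appl, HT.
    + intros (T & HT). apply H. eexists. apply rds_appr, HT.
    + intros (u & r & ->). apply H. eexists. apply rds_sigma1.
    + destruct s as [| [| v [|]]]; try discriminate (H1 _ eq_refl); auto.
      destruct v; eauto. split; eauto.
      intros l ->. apply H. eexists. apply rds_beta.
  - intros (Hs & Ht & Hls & Hm) (T & HT).
    inversion HT as [u l | l r Hl | u s1 s2 | v u r | ? ? S HS | ? ? S HS |]; subst.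
    + destruct Hm as [_ Hm]. now apply (Hm l).
    + destruct l as [| [] [|]]; simpl in *; auto.
    + apply Hls. now exists u, s1.
    + assert (lam_app (RApp (RBag [RLam u]) r)) by now exists u, r.
      destruct v; tauto.
    + apply Hs. now exists S.
    + apply Ht. now exists S.
Qed.

Definition taylor_val (V : term) (v : rval) : Prop :=
  match V with
  | Var x => v = RVar x
  | Lam N => exists t, taylor N t /\ v = RLam t
  | _ => False
  end.

Lemma Forall_map_RLam (P : rsimp -> Prop) l :
  Forall (fun v => exists t, P t /\ v = RLam t) l <->
  exists ts, Forall P ts /\ l = map RLam ts.
Proof.
  split.
  - induction 1 as [| v l (t & Ht & ->) _ (ts & Hts & ->)].
    + now exists [].
    + exists (t :: ts). auto.
  - intros (ts & Hts & ->). apply Forall_map. eapply Forall_impl; [| exact Hts]. eauto.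
Qed.

Lemma taylor_bag M l : taylor M (RBag l) <-> is_value M /\ Forall (taylor_val M) l.
Proof.
  destruct M; simpl.
  - split.
    + intros (k & [= ->]). split; auto. apply Forall_forall.
      intros v Hv. apply repeat_spec in Hv. assumption.
    + intros [_ H]. exists (length l). f_equal. apply Forall_eq_repeat.
      eapply Forall_impl; [| exact H]. auto.
  - pose proof (Forall_map_RLam (taylor M) l) as H. split.
    + intros (ts & Hts & [= ->]). split; auto. apply H. eauto.
    + intros [_ (ts & Hts & ->)%H]. eauto.
  - split; [intros (? & ? & _ & _ & [=]) | tauto].
  - tauto.
Qed.

Lemma taylor_value V t : is_value V -> taylor V t -> exists l, t = RBag l.
Proof. destruct V; simpl; try tauto; intros _; [intros (? & ->) | intros (? & _ & ->)]; eauto. Qed.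

Lemma taylor_lift M : forall k c t, taylor (lift k c M) t <->
  exists t0, taylor M t0 /\ t = rlifts k c t0.
Proof.
  induction M as [x | M IH | P IHP Q IHQ |]; intros k c t.
  - assert (H : forall n, rlifts k c (RBag (repeat (RVar x) n)) =
      RBag (repeat (if x <? c then RVar x else RVar (x + k)) n)).
    { intros n. now rewrite rlifts_bag, map_repeat. }
    simpl. split.
    + intros Ht. assert (exists n, t = RBag (repeat (if x <? c then RVar x else RVar (x + k)) n))
        as (n & ->) by (destruct (x <? c); assumption).
      exists (RBag (repeat (RVar x) n)). split; [now exists n | symmetry; apply H].
    + intros (? & (n & ->) & ->). rewrite H. destruct (x <? c); now exists n.
  - simpl. split.
    + intros (ts & Hts & ->).
      assert (exists us, Forall (taylor M) us /\ ts = map (rlifts k (S c)) us) as (us & Hus & ->).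
      { induction Hts as [| u ts Hu _ (us & ? & ->)].
        - now exists [].
        - apply IH in Hu as (u0 & ? & ->). exists (u0 :: us). auto. }
      exists (RBag (map RLam us)). split; [eauto |].
      rewrite rlifts_bag, !map_map. reflexivity.
    + intros (? & (us & Hus & ->) & ->). exists (map (rlifts k (S c)) us). split.
      * apply Forall_map. eapply Forall_impl; [| exact Hus]. intros u Hu. apply IH. eauto.
      * rewrite rlifts_bag, !map_map. reflexivity.
  - simpl. split.
    + intros (s1 & s2 & (u1 & ? & ->)%IHP & (u2 & ? & ->)%IHQ & ->).
      exists (RApp u1 u2). eauto 10.
    + intros (? & (u1 & u2 & ? & ? & ->) & ->). simpl.
      exists (rlifts k c u1), (rlifts k c u2). rewrite IHP, IHQ. eauto 10.
  - simpl. firstorder.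
Qed.

(* [tri t M]: t results from a Taylor-like approximation of M in which the elements
   of a bag, and the subterms of t in general, may see different reducts of M. This
   freedom makes the relation stable under arbitrary resource steps. *)
Inductive triv : rval -> term -> Prop :=
| triv_var n : triv (RVar n) (Var n)
| triv_lam t N : tri t N -> triv (RLam t) (Lam N)
with tri : rsimp -> term -> Prop :=
| tri_bag l V M : star red_v M V -> is_value V -> Forall (fun v => triv v V) l ->
    tri (RBag l) M
| tri_app s t P Q M : star red_v M (App P Q) -> tri s P -> tri t Q -> tri (RApp s t) M.

Lemma tri_expansion t M N : star red_v M N -> tri t N -> tri t M.
Proof.
  intros HMN Ht. destruct Ht as [l V N | s t P Q N].
  - apply tri_bag with V; auto. eapply rt_trans; eassumption.
  - apply tri_app with P Q; auto. eapply rt_trans; eassumption.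
Qed.

Lemma taylor_tri M : forall t, taylor M t -> tri t M.
Proof.
  induction M as [x | M IH | P IHP Q IHQ |]; intros t Ht.
  - destruct Ht as (n & ->). apply tri_bag with (Var x); simpl; auto using rt_refl.
    apply Forall_forall. intros v Hv. apply repeat_spec in Hv as ->. constructor.
  - destruct Ht as (ts & Hts & ->). apply tri_bag with (Lam M); simpl; auto using rt_refl.
    apply Forall_map. eapply Forall_impl; [| exact Hts]. intros. constructor. auto.
  - destruct Ht as (s1 & s2 & ? & ? & ->). eapply tri_app; eauto using rt_refl.
  - destruct Ht.
Qed.

Lemma tri_lift :
  (forall v V k c, triv v V -> triv (rliftv k c v) (lift k c V)) /\
  (forall t M k c, tri t M -> tri (rlifts k c t) (lift k c M)).
Proof.
  assert (H : (forall v, forall V k c, triv v V -> triv (rliftv k c v) (lift k c V)) /\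
    (forall t, forall M k c, tri t M -> tri (rlifts k c t) (lift k c M)));
    [| destruct H; split; assumption].
  apply resource_ind.
  - intros n V k c H. inversion H; subst. simpl. destruct (n <? c); constructor.
  - intros t IH V k c H. inversion H; subst. simpl. constructor. auto.
  - intros s t IHs IHt M k c H. inversion H as [| ? ? P Q ? HM]; subst. simpl.
    apply tri_app with (lift k c P) (lift k c Q); auto.
    now apply (red_v_star_lift k c) in HM.
  - intros l IH M k c H. inversion H as [? V ? HM HV Hl |]; subst. rewrite rlifts_bag.
    apply tri_bag with (lift k c V).
    + now apply red_v_star_lift.
    + now apply is_value_lift.
    + apply Forall_map. rewrite Forall_forall in *. auto.
Qed.

(** The elements of a bag share the outer value [W], only their bodies choose reducts of their own.
    Hence the single substitution of [W] suits every way of distributing [vs] over the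
    occurrences. *)
Lemma tri_lsub W : is_value W ->
  (forall d vs v v', lsubv d vs v v' -> forall V, Forall (fun w => triv w W) vs ->
    triv v V -> triv v' (subst d W V)) /\
  (forall d vs t t', lsubs d vs t t' -> forall M, Forall (fun w => triv w W) vs ->
    tri t M -> tri t' (subst d W M)) /\
  (forall d vs l l', lsubbag d vs l l' -> forall V, Forall (fun w => triv w W) vs ->
    Forall (fun v => triv v V) l -> Forall (fun v => triv v (subst d W V)) l').
Proof.
  intros HW.
  assert (Hsplit : forall vs vs1 vs2, Permutation vs (vs1 ++ vs2) ->
    Forall (fun w => triv w W) vs ->
    Forall (fun w => triv w W) vs1 /\ Forall (fun w => triv w W) vs2).
  { intros vs vs1 vs2 Hp H. apply Forall_app. eapply Permutation_Forall; eassumption. }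
  apply lsub_ind.
  - intros d w V Hw H. inversion H; subst. simpl. rewrite Nat.eqb_refl.
    apply tri_lift. now inversion Hw.
  - intros d n Hn V _ H. inversion H; subst. simpl. nat_cases; try lia; constructor.
  - intros d vs t t' _ IH V Hvs H. inversion H; subst. simpl. constructor. auto.
  - intros d vs vs1 vs2 s s' t t' Hp _ IHs _ IHt M Hvs H.
    destruct (Hsplit _ _ _ Hp Hvs). inversion H as [| ? ? P Q ? HM]; subst.
    apply (red_v_star_subst d W) in HM; auto. eapply tri_app; [exact HM | |]; auto.
  - intros d vs l l' _ IH M Hvs H. inversion H as [? V ? HM HV Hl |]; subst.
    apply tri_bag with (subst d W V); auto using is_value_subst, red_v_star_subst.
  - intros. constructor.
  - intros d vs vs1 vs2 v v' l l' Hp _ IHv _ IHl V Hvs H.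
    destruct (Hsplit _ _ _ Hp Hvs). inversion H; subst. constructor; auto.
Qed.

Lemma tri_lam_inv t P : tri (RBag [RLam t]) P ->
  exists N, star red_v P (Lam N) /\ tri t N.
Proof.
  intros H. inversion H as [? V ? HP HV Hl |]; subst.
  apply Forall_inv in Hl. inversion Hl; subst. eauto.
Qed.

(** A root step is mirrored in the term: reduce [M] until the corresponding redex appears, contract
    it, and absorb the path by [tri_expansion]. Inner steps follow from the induction hypotheses,
    and rule (0) has no reduct to consider. *)
Lemma tri_red :
  (forall v S, redv v S -> forall v' V, S v' -> triv v V -> triv v' V) /\
  (forall t S, reds t S -> forall t' M, S t' -> tri t M -> tri t' M).
Proof.
  apply red_ind.
  - intros t S _ IH v' V (t' & Ht & ->) H. inversion H; subst. constructor. eauto.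
  - intros t vs t' M Ht H. inversion H as [| ? ? P Q ? HM HP HQ]; subst.
    apply tri_lam_inv in HP as (N & HP & HN).
    inversion HQ as [? V ? HQV HV Hvs |]; subst.
    apply tri_expansion with (subst 0 V N).
    + eapply rt_trans; [exact HM |].
      eapply rt_trans; [apply red_v_star_app; eassumption |].
      now apply rt_step, rv_beta.
    + eapply (proj1 (proj2 (tri_lsub V HV))); eassumption.
  - intros l t _ t' M [].
  - intros t s1 s2 t' M -> H. inversion H as [| ? ? P Q ? HM HP HQ]; subst.
    inversion HP as [| ? ? P1 P2 ? HP12 HP1 HP2]; subst.
    apply tri_lam_inv in HP1 as (N & HP1 & HN).
    apply tri_expansion with (App (Lam (App N (lift 1 0 Q))) P2).
    + eapply rt_trans; [exact HM |].
      eapply rt_trans; [apply red_v_star_app; [| apply rt_refl] |].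
      * eapply rt_trans; [exact HP12 |]. apply red_v_star_app; [exact HP1 | apply rt_refl].
      * apply rt_step, rv_sigma1.
    + eapply tri_app; [apply rt_refl | | exact HP2].
      eapply tri_bag; [apply rt_refl | simpl; auto |]. repeat constructor.
      eapply tri_app; [apply rt_refl | exact HN |]. now apply tri_lift.
  - intros v t s t' M -> H. inversion H as [| ? ? P Q ? HM HP HQ]; subst.
    inversion HQ as [| ? ? P1 P2 ? HP12 HP1 HP2]; subst.
    apply tri_lam_inv in HP1 as (N & HP1 & HN).
    inversion HP as [? V ? HPV HV Hv |]; subst. apply Forall_inv in Hv.
    apply tri_expansion with (App (Lam (App (lift 1 0 V) N)) P2).
    + eapply rt_trans; [exact HM |].
      eapply rt_trans; [apply red_v_star_app; [exact HPV |] |].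
      * eapply rt_trans; [exact HP12 |]. apply red_v_star_app; [exact HP1 | apply rt_refl].
      * now apply rt_step, rv_sigma3.
    + eapply tri_app; [apply rt_refl | | exact HP2].
      eapply tri_bag; [apply rt_refl | simpl; auto |]. repeat constructor.
      eapply tri_app; [apply rt_refl | | exact HN].
      eapply tri_bag; [apply rt_refl | now apply is_value_lift |].
      repeat constructor. now apply tri_lift.
  - intros s t S _ IH t' M (s' & Hs & ->) H. inversion H; subst. eapply tri_app; eauto.
  - intros s t S _ IH t' M (s' & Hs & ->) H. inversion H; subst. eapply tri_app; eauto.
  - intros l1 v l2 S _ IH t' M (v' & Hv & ->) H.
    inversion H as [? V ? HM HV Hl |]; subst. eapply tri_bag; eauto.
    apply Forall_app in Hl as [H1 H2]. inversion H2; subst.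
    apply Forall_app. split; auto.
Qed.

Lemma tri_may_steps s t M : star may_step s t -> tri s M -> tri t M.
Proof.
  intros H. induction H as [s t (S & HS & Ht) | |]; auto.
  intros. eapply (proj2 tri_red); eassumption.
Qed.

(** If the contracted redex had a copy in [t], then [t] would contain a resource redex. So the step
    takes place under an abstraction of which [t] holds no copy, and [t] does not notice it. *)
Lemma taylor_normal_red M N t :
  star red_v M N -> ~ reducible t -> taylor M t -> taylor N t.
Proof.
  intros H Hn. induction H as [M N H | | M N P _ IH1 _ IH2]; auto. revert t Hn.
  induction H as [M V HV | M N P | V M N HV | M M' _ IH | M M' N _ IH | M N N' _ IH];
    intros t Hn.
  - intros (s1 & s2 & (ts & _ & ->) & H2 & ->).
    apply (taylor_value _ _ HV) in H2 as (l & ->).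
    apply normal_app in Hn as (_ & _ & _ & Hn). destruct ts as [| ? []]; simpl in Hn; try tauto.
    destruct Hn as [_ Hn]. now destruct (Hn l).
  - intros (s1 & s2 & (r1 & r2 & (ts & _ & ->) & _ & ->) & _ & ->).
    apply normal_app in Hn as (Hn & _ & Hl & _). apply normal_app in Hn as (_ & _ & _ & Hn).
    destruct ts as [| u []]; simpl in Hn; try tauto. destruct Hl. now exists u, r2.
  - intros (s1 & s2 & H1 & (r1 & r2 & (ts & _ & ->) & _ & ->) & ->).
    apply (taylor_value _ _ HV) in H1 as (l & ->).
    apply normal_app in Hn as (_ & Hn' & _ & Hn). apply normal_app in Hn' as (_ & _ & _ & Hn').
    destruct ts as [| u []]; simpl in Hn'; try tauto.
    assert (lam_app (RApp (RBag [RLam u]) r2)) by now exists u, r2.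
    destruct l as [| [] []]; simpl in Hn; tauto.
  - intros (ts & Hts & ->). exists ts. split; auto.
    apply normal_bag in Hn. rewrite Forall_map in Hn.
    rewrite Forall_forall in *. intros u Hu. apply IH; [apply (Hn u Hu) | auto].
  - intros (s1 & s2 & H1 & H2 & ->). apply normal_app in Hn as (? & ? & _).
    exists s1, s2. auto.
  - intros (s1 & s2 & H1 & H2 & ->). apply normal_app in Hn as (? & ? & _).
    exists s1, s2. auto.
Qed.

(** This is where confluence enters: the reducts chosen by [v] and by [l] have a common reduct, and
    normal elements persist down to it. *)
Lemma taylor_normal_bag_join V V1 V2 v l :
  star red_v V V1 -> star red_v V V2 -> ~ reducible (RBag (v :: l)) ->
  taylor V1 (RBag [v]) -> taylor V2 (RBag l) ->
  exists V', star red_v V V' /\ taylor V' (RBag (v :: l)).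
Proof.
  intros H1 H2 Hn Hv Hl. destruct (red_v_confluent _ _ _ H1 H2) as (V' & H3 & H4).
  apply normal_bag in Hn. inversion Hn; subst.
  apply (taylor_normal_red _ _ _ H3) in Hv; [| apply normal_bag; auto].
  apply (taylor_normal_red _ _ _ H4) in Hl; [| now apply normal_bag].
  exists V'. split; [eapply rt_trans; eassumption |].
  rewrite taylor_bag in *. destruct Hv as [? Hv], Hl as [? Hl]. split; auto.
  constructor; auto. now apply Forall_inv in Hv.
Qed.

Lemma tri_normal :
  (forall v V, normal_val v -> triv v V ->
    exists V', star red_v V V' /\ taylor V' (RBag [v])) /\
  (forall t M, ~ reducible t -> tri t M -> exists N, star red_v M N /\ taylor N t).
Proof.
  apply (resource_ind
    (fun v => forall V, normal_val v -> triv v V ->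
      exists V', star red_v V V' /\ taylor V' (RBag [v]))
    (fun t => forall M, ~ reducible t -> tri t M ->
      exists N, star red_v M N /\ taylor N t)).
  - intros n V _ H. inversion H; subst. exists (Var n). split; [apply rt_refl |].
    now exists 1.
  - intros t IH V Hn H. inversion H as [| ? N HN]; subst.
    destruct (IH N Hn HN) as (N' & ? & ?). exists (Lam N').
    split; [now apply red_v_star_lam |]. exists [t]. auto.
  - intros s t IHs IHt M Hn H. apply normal_app in Hn as (Hs & Ht & _).
    inversion H as [| ? ? P Q ? HM HP HQ]; subst.
    destruct (IHs P Hs HP) as (P' & ? & ?), (IHt Q Ht HQ) as (Q' & ? & ?).
    exists (App P' Q'). split.
    + eapply rt_trans; [exact HM | now apply red_v_star_app].
    + exists s, t. auto.
  - intros l IH M Hn H. inversion H as [? V ? HM HV Hl |]; subst.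
    assert (exists V', star red_v V V' /\ taylor V' (RBag l)) as (V' & ? & ?).
    { clear H. induction Hl as [| v l Hv Hl IHl].
      - exists V. split; [apply rt_refl |]. apply taylor_bag. auto.
      - inversion IH as [| ? ? IHv IHr]; subst. pose proof Hn as Hn'.
        apply normal_bag in Hn'. inversion Hn' as [| ? ? Hnv Hnl]; subst.
        destruct (IHv V Hnv Hv) as (V1 & ? & ?).
        destruct (IHl IHr) as (V2 & ? & ?); [now apply normal_bag |].
        now apply (taylor_normal_bag_join V V1 V2). }
    exists V'. split; [eapply rt_trans; eassumption | assumption].
Qed.

(** * Approximants and backward simulation *)

(** Matching on the smaller term alone makes the transitivity case a composition of two
    inversions. *)
Lemma sqle_inv A N : sqle A N ->
  match A with
  | Var _ => N = A
  | Lam A' => exists N', N = Lam N' /\ sqle A' N'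
  | App A1 A2 => exists N1 N2, N = App N1 N2 /\ sqle A1 N1 /\ sqle A2 N2
  | Bot => N = Bot \/ is_value N
  end.
Proof.
  induction 1 as [M | M N P _ IH1 _ IH2 | | | |]; simpl; eauto 10.
  - destruct M; eauto 10 using sq_refl.
  - destruct M.
    + now subst.
    + destruct IH1 as (N' & -> & ?). destruct IH2 as (P' & -> & ?). eauto using sq_trans.
    + destruct IH1 as (N1 & N2 & -> & ? & ?). destruct IH2 as (P1 & P2 & -> & ? & ?).
      exists P1, P2. eauto using sq_trans.
    + destruct IH1 as [-> | HN]; auto.
      destruct N; simpl in HN; try contradiction.
      * subst. simpl. auto.
      * destruct IH2 as (? & -> & _). simpl. auto.
Qed.

Lemma Tn_taylor A : forall N, sqle A N -> bot_free N ->
  (forall t, Tn A t -> taylor N t) /\ (forall t, Tnh A t -> taylor N t).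
Proof.
  induction A as [x | A IH | P IHP Q IHQ |]; intros N HN%sqle_inv Hb.
  - subst N. split; auto. intros t ->. now exists 1.
  - destruct HN as (N' & -> & HN). split; [| intros ? []].
    intros t (ts & Hts & ->). exists ts. split; auto.
    eapply Forall_impl; [| exact Hts]. now apply IH.
  - destruct HN as (N1 & N2 & -> & H1 & H2). destruct Hb as [Hb1 Hb2].
    destruct (IHP _ H1 Hb1) as [IHP1 IHP2], (IHQ _ H2 Hb2) as [IHQ1 _].
    assert (Hh : forall t, (exists s1 s2, Tnh P s1 /\ Tn Q s2 /\ t = RApp s1 s2) ->
      taylor (App N1 N2) t).
    { intros t (s1 & s2 & ? & ? & ->). exists s1, s2. auto. }
    (* [Tn] departs from the spine clause only for an abstraction in function position, where the
       bag is a singleton. *)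
    split; [| exact Hh]. intros t Ht. destruct P; try (now apply Hh).
    destruct Ht as (s1 & s2 & Hs1 & Hs2 & ->). exists (RBag [RLam s1]), s2.
    repeat split; auto. apply IHP1. exists [s1]. auto.
  (* The empty bag belongs to the expansion of every value, and [bot_free] excludes the case where
     [N] is [Bot]. *)
  - split; [| intros ? []]. intros t ->. destruct HN as [-> | HN]; [destruct Hb |].
    apply taylor_bag. auto.
Qed.

Scheme isA_ind' := Minimality for isA Sort Prop
  with isB_ind' := Minimality for isB Sort Prop
  with isH_ind' := Minimality for isH Sort Prop.
Combined Scheme approximant_ind from isA_ind', isB_ind', isH_ind'.

Lemma Tn_isH_app H A t : isH H ->
  Tn (App H A) t <-> exists s1 s2, Tnh H s1 /\ Tn A s2 /\ t = RApp s1 s2.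
Proof. destruct 1; reflexivity. Qed.

Lemma Tn_isH H t : isH H -> Tn H t <-> Tnh H t.
Proof. destruct 1; [reflexivity |]. now apply Tn_isH_app. Qed.

Lemma normal_map_RLam ts : ~ reducible (RBag (map RLam ts)) <->
  Forall (fun t => ~ reducible t) ts.
Proof. rewrite normal_bag. apply Forall_map. Qed.

Lemma normal_repeat_RVar x n : ~ reducible (RBag (repeat (RVar x) n)).
Proof.
  apply normal_bag, Forall_forall. intros v Hv. apply repeat_spec in Hv as ->. exact I.
Qed.

(** The induction needs more than normality: arguments of a head variable must not enable sigma3,
    and the argument of an abstraction must be an application, or else beta would apply. *)
Lemma Tn_normal :
  (forall A, isA A -> forall t, Tn A t -> ~ reducible t) /\
  (forall B, isB B -> forall t, Tn B t -> ~ reducible t /\ ~ lam_app t) /\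
  (forall H, isH H -> forall t, Tn H t ->
    ~ reducible t /\ ~ lam_app t /\ exists s1 s2, t = RApp s1 s2).
Proof.
  apply approximant_ind.
  - intros B _ IH t Ht. now apply IH.
  - intros A H _ IHA _ IHH t (s1 & s2 & H1 & H2 & ->).
    destruct (IHH _ H2) as (? & ? & r1 & r2 & ->). apply normal_app.
    repeat split; auto; try discriminate.
    + apply normal_bag. constructor; [apply (IHA _ H1) | constructor].
    + intros (? & ? & [=]).
  - intros x t (n & ->). split; [apply normal_repeat_RVar | intros (? & ? & [=])].
  - intros A _ IH t (ts & Hts & ->). split; [| intros (? & ? & [=])].
    apply normal_map_RLam. eapply Forall_impl; [| exact Hts]. auto.
  - intros t ->. split; [apply normal_bag; constructor | intros (? & ? & [=])].
  - intros H _ IH t Ht. destruct (IH _ Ht) as (? & ? & _). auto.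
  - intros x B _ IH t (s1 & s2 & -> & H2 & ->). destruct (IH _ H2).
    split; [apply normal_app | split; [intros (? & ? & [=]) | eauto]].
    repeat split; auto; [apply (normal_repeat_RVar x 1) | intros (? & ? & [=])].
  - intros H A HH IHH _ IHA t Ht. apply Tn_isH_app in Ht as (s1 & s2 & H1 & H2 & ->); auto.
    apply Tn_isH in H1; auto. destruct (IHH _ H1) as (? & ? & r1 & r2 & ->).
    split; [apply normal_app | split; [intros (? & ? & [=]) | eauto]].
    repeat split; auto.
Qed.

(* No subterm is a redex of the rule (0). *)
Inductive zero_free_val : rval -> Prop :=
| zfv_var n : zero_free_val (RVar n)
| zfv_lam t : zero_free t -> zero_free_val (RLam t)
with zero_free : rsimp -> Prop :=
| zf_app s t : zero_free s -> zero_free t ->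
    (forall l, s = RBag l -> length l = 1) -> zero_free (RApp s t)
| zf_bag l : Forall zero_free_val l -> zero_free (RBag l).

Lemma normal_zero_free t : ~ reducible t -> zero_free t.
Proof.
  revert t. apply (resource_ind (fun v => normal_val v -> zero_free_val v)
    (fun t => ~ reducible t -> zero_free t)).
  - constructor.
  - intros. constructor. auto.
  - intros s t IHs IHt (Hs & Ht & _ & H)%normal_app. constructor; auto.
    intros l ->. now destruct l as [| [] []].
  - intros l IH H%normal_bag. constructor. rewrite Forall_forall in *. auto.
Qed.

Lemma zero_free_lift :
  (forall v, forall k c, zero_free_val (rliftv k c v) -> zero_free_val v) /\
  (forall t, forall k c, zero_free (rlifts k c t) -> zero_free t).
Proof.
  apply resource_ind.
  - constructor.
  - intros t IH k c H. inversion H; subst. constructor. eauto.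
  - intros s t IHs IHt k c H. inversion H as [? ? ? ? Hl |]; subst. constructor; eauto.
    intros l ->. rewrite <- (length_map (rliftv k c)). now apply Hl.
  - intros l IH k c H. rewrite rlifts_bag in H. inversion H as [| ? Hl]; subst. constructor.
    rewrite Forall_map in Hl. rewrite Forall_forall in *. eauto.
Qed.

Lemma lsubs_bag_length d vs t l : lsubs d vs t (RBag l) ->
  exists m, t = RBag m /\ length m = length l.
Proof.
  intros H. inversion H as [| ? ? m ? Hm]; subst. exists m. split; auto.
  clear H. induction Hm; simpl; auto.
Qed.

Lemma zero_free_bag_iff l : zero_free (RBag l) <-> Forall zero_free_val l.
Proof. split; [now inversion 1 | now constructor]. Qed.

(** Read [t] along [P]: a bag that stems from a copy of [V] is moved to [vs], and [p] holds in its
    place a bag with as many copies of the variable. *)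
Lemma taylor_subst_inv V : is_value V -> forall P c t,
  taylor (subst c V P) t -> zero_free t ->
  exists p vs, taylor P p /\ zero_free p /\
    taylor V (RBag vs) /\ zero_free (RBag vs) /\ lsubs c vs p t.
Proof.
  intros HV.
  assert (Hnil : taylor V (RBag []) /\ zero_free (RBag [])).
  { rewrite taylor_bag, zero_free_bag_iff. auto. }
  assert (Happ : forall l m, taylor V (RBag l) -> zero_free (RBag l) ->
    taylor V (RBag m) -> zero_free (RBag m) ->
    taylor V (RBag (l ++ m)) /\ zero_free (RBag (l ++ m))).
  { intros l m. rewrite !taylor_bag, !zero_free_bag_iff, !Forall_app. tauto. }
  induction P as [x | P IH | P IHP Q IHQ |]; intros c t Ht Hz.
  - simpl in Ht. destruct (Nat.eqb_spec x c) as [-> | Hx].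
    + apply taylor_lift in Ht as (t0 & Ht & ->).
      destruct (taylor_value _ _ HV Ht) as (l & ->).
      apply zero_free_lift in Hz.
      exists (RBag (repeat (RVar c) (length l))), l. repeat split; auto.
      * now exists (length l).
      * apply normal_zero_free, normal_repeat_RVar.
      * rewrite rlifts_bag. constructor. clear.
        induction l as [| v l IH]; simpl; [constructor |].
        now apply lsb_cons with [v] l; [| constructor |].
    + assert (Hm : exists n, t = RBag (repeat (RVar (if x <? c then x else x - 1)) n)).
      { nat_cases; try lia; assumption. }
      destruct Hm as (n & ->). exists (RBag (repeat (RVar x) n)), [].
      repeat split; try tauto.
      * now exists n.
      * apply normal_zero_free, normal_repeat_RVar.
      * constructor. clear Ht Hz. induction n as [| n IHn]; simpl; [constructor |].
        apply lsb_cons with [] []; [reflexivity | now constructor | exact IHn].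
  - destruct Ht as (ts & Hts & ->).
    apply zero_free_bag_iff in Hz. rewrite Forall_map in Hz.
    assert (H : exists ps vs, Forall (taylor P) ps /\ Forall zero_free ps /\
      taylor V (RBag vs) /\ zero_free (RBag vs) /\
      lsubbag c vs (map RLam ps) (map RLam ts)).
    { induction Hts as [| t ts Ht _ IHts].
      - exists [], []. simpl. intuition constructor.
      - inversion Hz as [| ? ? Hzt Hzts]; subst.
        destruct (IHts Hzts) as (ps & vs & ? & ? & ? & ? & ?).
        inversion Hzt as [| ? Hzt']; subst.
        destruct (IH _ _ Ht Hzt') as (p & ws & ? & ? & ? & ? & ?).
        exists (p :: ps), (ws ++ vs).
        destruct (Happ ws vs) as [? ?]; auto. repeat split; auto.
        simpl. apply lsb_cons with ws vs; auto. now constructor. }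
    destruct H as (ps & vs & ? & ? & ? & ? & ?).
    exists (RBag (map RLam ps)), vs. repeat split; auto.
    + now exists ps.
    + constructor. apply Forall_map. eapply Forall_impl; [| eassumption]. now constructor.
    + now constructor.
  - destruct Ht as (t1 & t2 & Ht1 & Ht2 & ->). inversion Hz as [? ? Hz1 Hz2 Hl |]; subst.
    destruct (IHP _ _ Ht1 Hz1) as (p1 & vs1 & ? & ? & ? & ? & Hs1).
    destruct (IHQ _ _ Ht2 Hz2) as (p2 & vs2 & ? & ? & ? & ? & Hs2).
    destruct (Happ vs1 vs2) as [? ?]; auto.
    exists (RApp p1 p2), (vs1 ++ vs2). repeat split; auto.
    + now exists p1, p2.
    + constructor; auto. intros m ->. inversion Hs1 as [| ? ? ? l Hm]; subst.
      destruct (lsubs_bag_length _ _ _ _ Hs1) as (m' & [= <-] & ->). now apply Hl.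
    + now apply lss_app with vs1 vs2.
  - destruct Ht.
Qed.

Lemma may_steps_app s s' t t' : star may_step s s' -> star may_step t t' ->
  star may_step (RApp s t) (RApp s' t').
Proof.
  intros Hs Ht. apply rt_trans with (RApp s' t).
  - revert s s' Hs. apply (star_map may_step may_step (fun x => RApp x t)).
    intros s s' (S & HS & H). apply rt_step. eexists. split; [apply rds_appl, HS |]. simpl. eauto.
  - revert t t' Ht. apply star_map.
    intros t t' (S & HS & H). apply rt_step. eexists. split; [apply rds_appr, HS |]. simpl. eauto.
Qed.

(** The prefix [l] collects the elements already reduced, so that the induction always acts on the
    head of the rest. *)
Lemma may_steps_bag l ss ts : Forall2 (star may_step) ss ts ->
  star may_step (RBag (l ++ map RLam ss)) (RBag (l ++ map RLam ts)).
Proof.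
  intros H. revert l. induction H as [| s t ss ts Hst _ IH]; intros l; [apply rt_refl |].
  simpl. apply rt_trans with (RBag (l ++ RLam t :: map RLam ss)).
  - clear IH. revert s t Hst.
    apply (star_map may_step may_step (fun s => RBag (l ++ RLam s :: map RLam ss))).
    intros s t (S & HS & H). apply rt_step.
    eexists. split; [apply rds_bag, rdv_lam, HS |]. simpl. eauto.
  - change (RLam t :: map RLam ss) with ([RLam t] ++ map RLam ss).
    change (RLam t :: map RLam ts) with ([RLam t] ++ map RLam ts).
    rewrite !app_assoc. apply IH.
Qed.

Lemma may_steps_to_bag s l : star may_step s (RBag l) ->
  forall m, s = RBag m -> length m = length l.
Proof.
  intros H%clos_rt_rt1n. remember (RBag l) as t eqn:E. revert l E.
  induction H as [s | s s1 t (S & HS & H1) _ IH]; intros l E m Hm; subst.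
  - congruence.
  - inversion HS as [ | | | | | | l1 v l2 V HV]; subst.
    destruct H1 as (v' & _ & ->). specialize (IH _ eq_refl _ eq_refl).
    rewrite length_app in *. exact IH.
Qed.

(** A sigma step of the calculus can be undone on [t] only if the bag of the abstraction it creates
    is a singleton, which [zero_free] ensures. The property is also established for [s], so that
    steps can be chained. *)
Lemma taylor_red_v_inv M N : red_v M N -> forall t, taylor N t -> zero_free t ->
  exists s, taylor M s /\ zero_free s /\ star may_step s t.
Proof.
  induction 1 as [M V HV | M N P | V M N HV | M M' _ IH | M M' N _ IH | M N N' _ IH];
    intros t Ht Hz.
  - destruct (taylor_subst_inv V HV _ _ _ Ht Hz) as (p & vs & ? & ? & ? & Hvs & Hs).
    exists (RApp (RBag [RLam p]) (RBag vs)). repeat split.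
    + exists (RBag [RLam p]), (RBag vs). repeat split; auto. exists [p]. auto.
    + constructor; auto; [repeat constructor; assumption |]. now intros l [= <-].
    + apply rt_step. eexists. split; [apply rds_beta | exact Hs].
  - destruct Ht as (s1 & n & (ts & Hts & ->) & Hn & ->).
    inversion Hz as [? ? Hz1 Hzn Hl |]; subst.
    destruct ts as [| u [| ? ?]]; try discriminate (Hl _ eq_refl).
    apply Forall_inv in Hts as (a & b & Ha & Hb & ->).
    apply taylor_lift in Hb as (b0 & Hb & ->).
    apply zero_free_bag_iff, Forall_inv in Hz1. inversion Hz1 as [| ? Hz2]; subst.
    inversion Hz2 as [? ? Hza Hzb Hl' |]; subst. apply zero_free_lift in Hzb.
    exists (RApp (RApp (RBag [RLam a]) n) b0). repeat split.
    + exists (RApp (RBag [RLam a]) n), b0. repeat split; auto.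
      exists (RBag [RLam a]), n. repeat split; auto. exists [a]. auto.
    + constructor; auto; [| discriminate].
      constructor; auto; [repeat constructor; assumption |]. now intros l [= <-].
    + apply rt_step. eexists. split; [apply rds_sigma1 | reflexivity].
  - destruct Ht as (s1 & n & (ts & Hts & ->) & Hn & ->).
    inversion Hz as [? ? Hz1 Hzn Hl |]; subst.
    destruct ts as [| u [| ? ?]]; try discriminate (Hl _ eq_refl).
    apply Forall_inv in Hts as (a & b & Ha & Hb & ->).
    apply taylor_lift in Ha as (a0 & Ha & ->).
    apply zero_free_bag_iff, Forall_inv in Hz1. inversion Hz1 as [| ? Hz2]; subst.
    inversion Hz2 as [? ? Hza Hzb Hl' |]; subst. apply zero_free_lift in Hza.
    (* The value stands in function position under the abstraction, so [zero_free] forces its bag to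
       be a singleton, as sigma3 requires. *)
    destruct (taylor_value _ _ HV Ha) as (m & ->). specialize (Hl' (map (rliftv 1 0) m) eq_refl).
    rewrite length_map in Hl'. destruct m as [| v [| ? ?]]; try discriminate Hl'.
    exists (RApp (RBag [v]) (RApp (RBag [RLam b]) n)). repeat split.
    + exists (RBag [v]), (RApp (RBag [RLam b]) n). repeat split; auto.
      exists (RBag [RLam b]), n. repeat split; auto. exists [b]. auto.
    + constructor; auto; [| now intros l [= <-]].
      constructor; auto; [repeat constructor; assumption |]. now intros l [= <-].
    + apply rt_step. eexists. split; [apply rds_sigma3 | reflexivity].
  - destruct Ht as (ts & Hts & ->). apply zero_free_bag_iff in Hz. rewrite Forall_map in Hz.
    assert (H : exists ss, Forall (taylor M) ss /\ Forall zero_free ss /\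
      Forall2 (star may_step) ss ts).
    { induction Hts as [| t ts Ht _ IHts].
      - exists []. auto.
      - inversion Hz as [| ? ? Hzt Hzts]; subst. inversion Hzt as [| ? Hzt']; subst.
        destruct (IHts Hzts) as (ss & ? & ? & ?), (IH _ Ht Hzt') as (s & ? & ? & ?).
        exists (s :: ss). auto. }
    destruct H as (ss & ? & ? & ?). exists (RBag (map RLam ss)). repeat split.
    + now exists ss.
    + constructor. apply Forall_map. eapply Forall_impl; [| eassumption]. now constructor.
    + now apply (may_steps_bag []).
  - destruct Ht as (t1 & t2 & Ht1 & Ht2 & ->). inversion Hz as [? ? Hz1 Hz2 Hl |]; subst.
    destruct (IH _ Ht1 Hz1) as (s1 & ? & ? & Hs). exists (RApp s1 t2). repeat split.
    + now exists s1, t2.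
    + constructor; auto. intros l ->.
      assert (exists m, t1 = RBag m) as (m & ->).
      { clear - Hs. apply clos_rt_rt1n in Hs. remember (RBag l) as s eqn:E. revert l E.
        induction Hs as [s | s s1 t (S & HS & H1) _ IH]; intros l E; subst; [eauto |].
        inversion HS; subst. destruct H1 as (v' & _ & ->). eauto. }
      rewrite (may_steps_to_bag _ _ Hs _ eq_refl). auto.
    + apply may_steps_app; [assumption | apply rt_refl].
  - destruct Ht as (t1 & t2 & Ht1 & Ht2 & ->). inversion Hz as [? ? Hz1 Hz2 Hl |]; subst.
    destruct (IH _ Ht2 Hz2) as (s2 & ? & ? & Hs). exists (RApp t1 s2). repeat split.
    + now exists t1, s2.
    + now constructor.
    + apply may_steps_app; [apply rt_refl | assumption].
Qed.

Lemma taylor_red_v_star_inv M N t : star red_v M N -> taylor N t -> zero_free t ->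
  exists s, taylor M s /\ zero_free s /\ star may_step s t.
Proof.
  intros H. revert t. induction H as [M N H | M | M N P _ IH1 _ IH2]; intros t Ht Hz.
  - eapply taylor_red_v_inv; eassumption.
  - exists t. auto using rt_refl.
  - destruct (IH2 _ Ht Hz) as (s & Hs & Hzs & ?). destruct (IH1 _ Hs Hzs) as (r & ? & ? & ?).
    exists r. repeat split; auto. eapply rt_trans; eassumption.
Qed.

Lemma Tn_BT_NF M t : bot_free M -> Tn_BT M t -> NF_taylor M t.
Proof.
  intros HM (A & (HA & N & HN & HMN & HAN) & Ht).
  pose proof (proj1 Tn_normal _ HA _ Ht) as Hn.
  apply (Tn_taylor _ _ HAN HN) in Ht.
  destruct (taylor_red_v_star_inv _ _ _ HMN Ht (normal_zero_free _ Hn)) as (s & Hs & _ & Hst).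
  exists s. split; auto. now apply may_steps_nf.
Qed.

(** * Reading an approximant off normal elements of a Taylor expansion *)

Definition app_of_lam (N : term) : Prop :=
  match N with App (Lam _) _ => True | _ => False end.

Definition spine (N : term) : Prop :=
  match N with App (Lam _) _ => False | App _ _ => True | _ => False end.

(** A whole list of terms is treated at once because the elements of a bag need one approximant for
    all their bodies. The last two clauses give the grammatical class required when [A] is used as
    an argument or as a head. *)
Definition common_approximant (N : term) (L : list rsimp) (A : term) : Prop :=
  isA A /\ sqle A N /\ Forall (Tn A) L /\
  (~ app_of_lam N -> isB A) /\ (spine N -> isH A).

Lemma app_of_lam_lam_app P Q t : taylor (App (Lam P) Q) t -> ~ reducible t -> lam_app t.
Proof.
  intros (s1 & s2 & (ts & _ & ->) & _ & ->) (_ & _ & _ & Hm)%normal_app.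
  destruct ts as [| u [| ? ?]]; simpl in Hm; try tauto. now exists u, s2.
Qed.

(** The bodies from all bags of [L] are pooled into one list; the final clause redistributes over
    [L] whatever is proved of the pool. *)
Lemma lam_bodies P L :
  Forall (fun t => ~ reducible t /\ taylor (Lam P) t) L ->
  exists ts, Forall (fun t => ~ reducible t /\ taylor P t) ts /\
    forall Q : rsimp -> Prop, Forall Q ts ->
      Forall (fun t => exists us, Forall Q us /\ t = RBag (map RLam us)) L.
Proof.
  induction 1 as [| t L [Hn (us & Hus & ->)] _ (ts & Hts & IH)].
  - exists []. split; auto.
  - exists (us ++ ts). apply normal_map_RLam in Hn. split.
    + apply Forall_app. split; auto. rewrite Forall_forall in *. auto.
    + intros Q [H1 H2]%Forall_app. constructor; eauto.
Qed.

Lemma app_components P Q L :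
  Forall (fun t => ~ reducible t /\ taylor (App P Q) t) L ->
  exists L1 L2, length L1 = length L /\ length L2 = length L /\
    Forall (fun t => ~ reducible t /\ taylor P t) L1 /\
    Forall (fun t => ~ reducible t /\ taylor Q t) L2 /\
    forall X Y Z : rsimp -> Prop,
      (forall s1 s2, X s1 -> Y s2 -> ~ reducible (RApp s1 s2) -> taylor P s1 -> Z (RApp s1 s2)) ->
      Forall X L1 -> Forall Y L2 -> Forall Z L.
Proof.
  induction 1 as [| t L [Hn (s1 & s2 & H1 & H2 & ->)] _ (L1 & L2 & ? & ? & ? & ? & IH)].
  - exists [], []. auto 10.
  - exists (s1 :: L1), (s2 :: L2). pose proof Hn as (? & ? & _)%normal_app.
    simpl. repeat split; auto.
    intros X Y Z HXYZ HX HY. inversion HX; inversion HY; subst.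
    constructor; eauto.
Qed.

(** [A] copies [N], except that an abstraction none of whose bodies occurs in [L] becomes [Bot]. As
    [L] is nonempty, some normal element witnesses that [N] has no redex in the parts visited, which
    therefore fit the grammar. *)
Lemma common_approximant_exists N : forall L, L <> [] ->
  Forall (fun t => ~ reducible t /\ taylor N t) L ->
  exists A, common_approximant N L A.
Proof.
  induction N as [x | N IH | P IHP Q IHQ |]; intros L HL H.
  - exists (Var x). repeat split; simpl; try tauto; try (repeat constructor).
    eapply Forall_impl; [| exact H]. now intros t [_ Ht].
  - destruct (lam_bodies _ _ H) as (ts & Hts & HQ).
    destruct ts as [| t ts].
    + exists Bot. repeat split; simpl; try tauto; try (repeat constructor).
      (* Over an empty pool even [False] holds of all bodies, so every bag of [L] is empty. *)
      eapply Forall_impl; [| apply (HQ (fun _ => False)); constructor].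
      intros t (us & Hus & ->). destruct Hus; [reflexivity | contradiction].
    + destruct (IH (t :: ts)) as (A & HA & HAN & HTn & _); [discriminate | assumption |].
      exists (Lam A). repeat split; simpl; try tauto; auto using sq_lam, A_B, B_lam.
  - destruct (app_components _ _ _ H) as (L1 & L2 & Hl1 & Hl2 & H1 & H2 & HC).
    assert (HL1 : L1 <> []) by (intros ->; now destruct L).
    assert (HL2 : L2 <> []) by (intros ->; now destruct L).
    assert (Hex : exists s1 s2, taylor P s1 /\ taylor Q s2 /\ ~ reducible (RApp s1 s2)).
    { destruct H as [| t L [? (s1 & s2 & ? & ? & ->)] _]; [contradiction | eauto]. }
    destruct Hex as (r1 & r2 & Hr1 & Hr2 & Hr).
    pose proof Hr as (Hn1 & Hn2 & Hnl & Hm)%normal_app.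
    destruct (IHP _ HL1 H1) as (A1 & HA1 & HN1 & HT1 & _ & HH1).
    destruct (IHQ _ HL2 H2) as (A2 & HA2 & HN2 & HT2 & HB2 & HH2).
    destruct P as [x | P | P1 P2 |].
    + exists (App (Var x) A2).
      assert (HH : isH (App (Var x) A2)).
      (* Were [Q] an abstraction applied to an argument, [r2] would form a sigma3 redex with the bag
         of [x]. *)
      { constructor. apply HB2. intros HQ.
        destruct Q as [| | [| Q1 | |] Q2 |]; try contradiction.
        apply app_of_lam_lam_app in Hr2; auto. destruct Hr1 as (n & ->).
        destruct n as [| [| ?]]; simpl in Hm; tauto. }
      repeat split; auto using A_B, B_head.
      * constructor; auto using sq_refl.
      * eapply HC; [| exact H1 | exact HT2].
        intros s1 s2 _ Hs2 (_ & _ & _ & Hm')%normal_app (n & ->).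
        destruct n as [| [| ?]]; simpl in Hm'; try tauto.
        now exists (RBag [RVar x]), s2.
    + pose proof (sqle_inv _ _ HN1) as Hinv.
      destruct Hr1 as (ts & Hts & ->).
      destruct ts as [| u [| ? ?]]; simpl in Hm; try tauto. destruct Hm as [Hm1 Hm2].
      (* A value [Q] would give a beta redex, and an applied abstraction a sigma3 redex; only a
         spine remains. *)
      assert (HH : isH A2).
      { apply HH2. destruct Q as [x | Q | [x | Q1 | Q1 Q3 |] Q2 |]; simpl; auto.
        - destruct (taylor_value (Var x) r2) as (l & ->); simpl; auto. now apply (Hm2 l).
        - destruct (taylor_value (Lam Q) r2) as (l & ->); simpl; auto. now apply (Hm2 l).
        - apply Hm1. now apply app_of_lam_lam_app with Q1 Q2. }
      assert (HA : exists A, A1 = Lam A).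
      { destruct A1 as [x | A | |]; eauto; exfalso.
        - destruct Hinv as (? & ? & ? & _). discriminate.
        (* If [A1] were [Bot], every function part would be the empty bag, a redex of rule (0). *)
        - assert (HF : Forall (fun _ => False) L).
          { eapply HC; [| exact HT1 | exact HT2].
            intros s1 s2 -> _ (_ & _ & _ & Hm)%normal_app _. exact Hm. }
          destruct HF; contradiction. }
      destruct HA as (A & ->). destruct Hinv as (P' & [= <-] & HAP).
      assert (HA : isA A) by (inversion HA1 as [? HB |]; subst; inversion HB as [| | | ? HI]; subst;
        [assumption | inversion HI]).
      exists (App (Lam A) A2). repeat split; simpl; try tauto.
      * now constructor.
      * constructor; auto using sq_lam.
      * eapply HC; [| exact HT1 | exact HT2].
        intros s1 s2 (us & Hus & ->) Hs2 (_ & _ & _ & Hm)%normal_app _.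
        destruct us as [| w [| ? ?]]; simpl in Hm; try tauto.
        exists w, s2. repeat split; auto. now inversion Hus.
    + assert (HA1H : isH A1).
      (* An abstraction as [P1] would make [r1] a [lam_app], hence a sigma1 redex at the root. *)
      { apply HH1. destruct P1; simpl; auto. now apply Hnl, app_of_lam_lam_app with P1 P2. }
      assert (HH : isH (App A1 A2)) by now constructor.
      exists (App A1 A2). repeat split; auto using A_B, B_head.
      * now constructor.
      * eapply HC; [| exact HT1 | exact HT2].
        intros s1 s2 Hs1 Hs2 _ _. apply Tn_isH_app; auto. apply Tn_isH in Hs1; eauto 10.
    + contradiction.
  - destruct H as [| t L [_ []]]. contradiction.
Qed.

Lemma NF_Tn_BT M t : bot_free M -> NF_taylor M t -> Tn_BT M t.
Proof.
  intros HM (s & Hs & (Hst & Hn)%nf_may_steps).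
  apply taylor_tri, (tri_may_steps _ _ _ Hst) in Hs.
  destruct (proj2 tri_normal _ _ Hn Hs) as (N & HMN & Ht).
  destruct (common_approximant_exists N [t]) as (A & HA & HAN & HT & _); auto; [discriminate |].
  exists A. split; [| now apply Forall_inv in HT].
  split; auto. exists N. repeat split; auto. eapply bot_free_red_v; eassumption.
Qed.

Theorem theorem4p11 (M : term) (HM : bot_free M) :
  rset_eq (Tn_BT M) (NF_taylor M).
Proof.
  (* The two sets already agree before closure under [eqs], so the same representative [u]
     serves. *)
  intros t. split; intros (u & Hu & ?); exists u; split; auto.
  - now apply Tn_BT_NF.
  - now apply NF_Tn_BT.
Qed.
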